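(* Let $n\ge 2$ and let $(M,g,v^m\,dvol_g)$ be an $(n+1)$-dimensional asymptotically Schwarzschild smooth metric measure space with non-compact boundary, with asymptotic constants $a\in\mathbb R$ and $0<s<1$ in asymptotic coordinates $x=(x_1,\dots,x_{n+1})$ coming from a diffeomorphism $\phi$. Suppose that either (i) $0\le m<1$, or (ii) $-1<m<0$ and the error term in the expansion of the metric, $E_{ij}=(\phi_*g)_{ij}-(1+a|x|^{1-n-m})\delta_{ij}$, has the form $E_{ij}=E^{0}\delta_{ij}+x_{n+1}E^{1}_{ij}$ with $E^{0}=O'(|x|^{s-n-m})$ and $E^1_{ij}=O'(|x|^{s-n-m-1})$. Then the limit defining the mass $\mathfrak m_{(g,v,m)}$ (computed in the coordinates $x$) exists and is finite, and $$\mathfrak m_{(g,v,m)}=(m+n)(m+n-1)\,a\,\sigma_{n,m},\qquad \sigma_{n,m}=\int_{|x|=1,\;x_{n+1}>0}x_{n+1}^m\,d\sigma .$$ Moreover, this limit is independent of the chosen asymptotic coordinates, in the following sense: if $y=(y_1,\dots,y_{n+1})$ is another set of asymptotic coordinates for the same space, coming from a diffeomorphism $\widetilde\phi$ (from the complement of a compact subset of $M$ onto $\{y\in\mathbb R^{n+1}_+ : |y|>1\}$), such that $$(\widetilde\phi_*g)_{ij}(y)=\left(1+\widetilde a|y|^{1-n-m}\right)\delta_{ij}+O'(|y|^{s-n-m}),$$ $$v\circ\widetilde\phi^{-1}(y)=\left(1+\tfrac{\widetilde a}{2}|y|^{1-n-m}\right)y_{n+1}+y_{n+1}O'(|y|^{s-n-m}),$$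 where, when $-1<m<0$, the error term in the expansion of $\widetilde\phi_*g$ has the form $O'(|y|^{s-n-m})\delta_{ij}+y_{n+1}O'(|y|^{s-n-m-1})$, then $\widetilde a=a$ (so the mass computed in the coordinates $y$ equals the mass computed in the coordinates $x$).
   Context: Notation: $\mathbb R^{n+1}_+=\{x\in\mathbb R^{n+1}: x_{n+1}\ge 0\}$, $\delta$ is the Euclidean metric, and a comma denotes a partial derivative. $O'(r^{\alpha})$ (with $r=|x|$) denotes a quantity whose norm is bounded by $Cr^{\alpha}$ and whose first derivatives are bounded in norm by $Cr^{\alpha-1}$ for some $C>0$ (for tensors: componentwise in the given coordinates). A smooth metric measure space $(M,g,v^m dvol_g)$ of dimension $n+1$ consists of an $(n+1)$-dimensional smooth manifold $M$ with boundary $\Sigma$ (not necessarily compact), a Riemannian metric $g$ on $M$ with volume element $dvol_g$, a smooth non-negative function $v$ on $M$ with $v^{-1}(0)=\Sigma$, and a real parameter $m$, here with $m>1-n$. It is called asymptotically Schwarzschild with non-compact boundary if there are a compact set $K\subset M$, a diffeomorphism $\phi:M\setminus K\to\{x\in\mathbb R^{n+1}_+:|x|>1\}$, and constants $a\in\mathbb R$, $0<s<1$ such that in the induced coordinates $$(\phi_*g)_{ij}(x)=\left(1+a|x|^{1-n-m}\right)\delta_{ij}+O'(|x|^{s-n-m}),\quad i,j=1,\dots,n+1,$$ $$v\circ\phi^{-1}(x)=\left(1+\tfrac a2|x|^{1-n-m}\right)x_{n+1}+x_{n+1}O'(|x|^{s-n-m}).$$ Its mass (computed in these coordinates) is, with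 $e=\phi_*g-\delta$ and $w=v\circ\phi^{-1}-x_{n+1}$, $$\mathfrak m_{(g,v,m)}=\lim_{\rho\to\infty}\Big\{\int_{|x|=\rho,\,x_{n+1}>0}\sum_{i=1}^{n+1}\mathbb U_i(e,w)\frac{x_i}{|x|}x_{n+1}^m\,d\sigma+\int_{|x|=\rho,\,x_{n+1}=0}\sum_{\alpha=1}^{n}\overline{\mathbb U}_\alpha(e,w)\frac{x_\alpha}{|x|}x_{n+1}^m\,d\overline\sigma\Big\},$$ where $d\sigma$, $d\overline\sigma$ are the Euclidean area elements (of dimensions $n$ and $n-1$), and $\mathbb U(e,w)$, $\overline{\mathbb U}(e,w)$ are the one-forms $$\mathbb U_i(e,w)=\sum_{j=1}^{n+1}(e_{ij,j}-e_{jj,i})+m x_{n+1}^{-1}e_{n+1\,i}-2m x_{n+1}^{-1}w_{,i},\qquad \overline{\mathbb U}_\alpha(e,w)=e_{n+1\,\alpha}.$$ In the integral over $\{|x|=\rho,\ x_{n+1}=0\}$ the integrand, which contains the factor $x_{n+1}^m$, is understood as its limit as $x_{n+1}\to0^+$ (with $x_{n+1}^0=1$ when $m=0$). *)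

(* Defs.v *)
From HB Require Import structures.
From mathcomp Require Import all_boot all_order all_algebra.
From mathcomp Require Import all_classical all_reals all_analysis.
From mathcomp Require Import measurable_realfun.

Set Implicit Arguments.
Unset Strict Implicit.
Unset Printing Implicit Defensive.

Import Order.TTheory GRing.Theory Num.Theory.
Import numFieldNormedType.Exports.

Local Open Scope classical_set_scope.
Local Open Scope ring_scope.

(* MathComp's norm on ['rV[R]_N] is the sup norm; [enorm] is the Euclidean one. *)
Definition enorm (R : realType) (N : nat) (x : 'rV[R]_N) : R :=
  Num.sqrt (\sum_(i < N) x 0 i ^+ 2).

Definition last_coord (R : realType) (n : nat) (x : 'rV[R]_n.+1) : R :=
  x 0 ord_max.

Definition half_space (R : realType) (n : nat) : set 'rV[R]_n.+1 :=
  [set x | 0 <= last_coord x].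

Arguments half_space R n : clear implicits.

Definition exterior (R : realType) (n : nat) : set 'rV[R]_n.+1 :=
  [set x | 0 <= last_coord x /\ 1 < enorm x].

Arguments exterior R n : clear implicits.

(** Differentiability on relatively open subsets of the half-space *)

Section WithinDerivatives.
Context {R : realType} {N : nat}.
Implicit Types (D : set 'rV[R]_N) (f : 'rV[R]_N -> R) (i : 'I_N) (x : 'rV[R]_N).

(* Only increments that stay in [D] are used: for [D] relatively open in the
   half-space, the derivative normal to the boundary is one-sided at boundary
   points, and all other derivatives are the usual two-sided ones. *)
Definition increments D i x : set_system R :=
  within [set h : R | D (x + h *: delta_mx 0 i)] (0 : R)^'.

Definition diff_quotient f i x (h : R) : R :=
  h^-1 * (f (x + h *: delta_mx 0 i) - f x).

Definition has_partial D f i x : Prop :=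
  cvg (diff_quotient f i x @ increments D i x).

Definition partial D f i x : R :=
  lim (diff_quotient f i x @ increments D i x).

Fixpoint partials D (s : seq 'I_N) f : 'rV[R]_N -> R :=
  if s is i :: s' then partial D (partials D s' f) i else f.

Definition smooth_on D f : Prop :=
  forall s : seq 'I_N,
    {within D, continuous (partials D s f)} /\
    (forall i x, D x -> has_partial D (partials D s f) i x).

Definition smooth_map_on D (P : nat) (F : 'rV[R]_N -> 'rV[R]_P) : Prop :=
  forall k, smooth_on D (fun x => F x 0 k).

Definition jacobian D (P : nat) (F : 'rV[R]_N -> 'rV[R]_P) x : 'M[R]_(P, N) :=
  \matrix_(k, i) partial D (fun y => F y 0 k) i x.

(* Components at [x] of the pullback under [F] of a bilinear form with
   components [G] at [F x]. *)
Definition pullback D (P : nat) (F : 'rV[R]_N -> 'rV[R]_P) (G : 'M[R]_P) x :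
    'M[R]_N :=
  (jacobian D F x)^T *m G *m jacobian D F x.

End WithinDerivatives.

(** Smooth manifolds with boundary *)

Record chart (R : realType) (n : nat) (M : topologicalType) := Chart {
  chart_dom : set M ;
  chart_coord : M -> 'rV[R]_n.+1 ;
  chart_point : 'rV[R]_n.+1 -> M }.

Section Charts.
Context {R : realType} {n : nat} {M : topologicalType}.
Implicit Types c : chart R n M.

Definition chart_cod c : set 'rV[R]_n.+1 := chart_coord c @` chart_dom c.

(* [chart_coord c] is a homeomorphism, with inverse [chart_point c], from the
   open set [chart_dom c] onto a relatively open subset of the half-space; the
   values outside [chart_dom c] and [chart_cod c] are irrelevant. *)
Definition is_chart c : Prop :=
  [/\ open (chart_dom c),
      exists2 O : set 'rV[R]_n.+1, open O & chart_cod c = O `&` half_space R n,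
      forall p, chart_dom c p -> chart_point c (chart_coord c p) = p,
      {within chart_dom c, continuous (chart_coord c)} &
      {within chart_cod c, continuous (chart_point c)}].

Definition overlap c c' : set 'rV[R]_n.+1 :=
  chart_coord c @` (chart_dom c `&` chart_dom c').

Definition transition c c' : 'rV[R]_n.+1 -> 'rV[R]_n.+1 :=
  fun x => chart_coord c' (chart_point c x).

Definition compatible c c' : Prop :=
  smooth_map_on (overlap c c') (transition c c') /\
  smooth_map_on (overlap c' c) (transition c' c).

End Charts.

Record manifold (R : realType) (n : nat) := Manifold {
  carrier :> topologicalType ;
  manifold_hausdorff : hausdorff_space carrier ;
  manifold_second_countable : @second_countable carrier ;
  atlas : set (chart R n carrier) ;
  chart_at : carrier -> chart R n carrier ;
  atlas_charts : forall c, atlas c -> is_chart c ;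
  chart_at_atlas : forall p, atlas (chart_at p) ;
  chart_at_dom : forall p, chart_dom (chart_at p) p ;
  atlas_compatible : forall c c', atlas c -> atlas c' -> compatible c c' }.

Definition boundary (R : realType) (n : nat) (M : manifold R n) : set M :=
  [set p | exists c,
    [/\ @atlas _ _ M c, chart_dom c p & last_coord (chart_coord c p) = 0]].

Arguments boundary {R n} M.

Definition smooth_function (R : realType) (n : nat) (M : manifold R n)
    (f : M -> R) : Prop :=
  forall c, @atlas _ _ M c ->
    smooth_on (chart_cod c) (fun x => f (chart_point c x)).

(* A metric is given by its component matrices in the charts of the atlas. *)
Record riemannian_metric (R : realType) (n : nat) (M : manifold R n) := Metric {
  components :> chart R n M -> 'rV[R]_n.+1 -> 'M[R]_n.+1 ;
  components_smooth : forall c, @atlas _ _ M c ->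
    forall i j, smooth_on (chart_cod c) (fun x => components c x i j) ;
  components_sym : forall c x, @atlas _ _ M c -> chart_cod c x ->
    (components c x)^T = components c x ;
  components_posdef : forall c x (u : 'rV[R]_n.+1), @atlas _ _ M c ->
    chart_cod c x -> u != 0 -> 0 < (u *m components c x *m u^T) 0 0 ;
  components_change : forall c c' x, @atlas _ _ M c -> @atlas _ _ M c' ->
    overlap c c' x ->
    components c x =
      pullback (overlap c c') (transition c c')
        (components c' (transition c c' x)) x }.

(** Smooth metric measure spaces *)

Record smms (R : realType) (n : nat) := SMMS {
  smms_space :> manifold R n ;
  met : riemannian_metric smms_space ;
  density : smms_space -> R ;
  weight : R ;
  density_smooth : smooth_function density ;
  density_ge0 : forall p, 0 <= density p ;
  density_zero : density @^-1` [set 0] = boundary smms_space ;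
  weight_gt : 1 - n%:R < weight }.

(** Euclidean surface measure on spheres *)

Definition image_measure d d' (T : measurableType d) (T' : measurableType d')
    (R : realType) (m : {measure set T -> \bar R}) (f : {mfun T >-> T'}) :
  {measure set T' -> \bar R}.
Proof.
refine [the {measure set T' -> \bar R} of pushforward m f].
exact: measurable_funP.
Defined.

Section SphereMeasure.
Context {R : realType}.
Implicit Type N : nat.

Local Notation RN N := (N.-tuple (measurableTypeR R)).

Definition row_of N (t : RN N) : 'rV[R]_N := \row_i tnth t i.

Definition cons_pair N (p : RN N * measurableTypeR R) : RN N.+1 :=
  [the N.+1.-tuple (measurableTypeR R) of p.2 :: p.1].

Lemma measurable_cons_pair N : measurable_fun [set: _] (@cons_pair N).
Proof. exact: measurable_cons. Qed.

HB.instance Definition _ N :=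
  isMeasurableFun.Build _ _ _ _ (@cons_pair N) (@measurable_cons_pair N).

Fixpoint lebesgueN N : {measure set (RN N) -> \bar R} :=
  match N return {measure set (RN N) -> \bar R} with
  | 0 => dirac [tuple]
  | N'.+1 => image_measure (lebesgueN N' \x lebesgue_measure)%E (@cons_pair N')
  end.

Definition radial_proj N (rho : R) (t : RN N) : RN N :=
  [tuple rho / enorm (row_of t) * tnth t i | i < N].

Lemma measurable_row_of_enorm N :
  measurable_fun [set: RN N] (fun t : RN N => enorm (row_of t)).
Proof.
apply: (@measurableT_comp _ _ _ _ _ _ (@Num.sqrt R)).
  by apply: continuous_measurable_fun; exact: sqrt_continuous.
apply: measurable_sum => i; under eq_fun do rewrite mxE.
by apply: measurable_funX; exact: measurable_tnth.
Qed.

Lemma measurable_radial_proj N (rho : R) :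
  measurable_fun [set: RN N] (@radial_proj N rho).
Proof.
apply/measurable_fun_tnthP => i.
rewrite [X in measurable_fun _ X](_ : _ = (fun t : RN N =>
    rho * (enorm (row_of t) `^ (-1)) * tnth t i)); last first.
  by apply/funext => t /=; rewrite tnth_mktuple powR_inv1// sqrtr_ge0.
apply: measurable_funM; last exact: measurable_tnth.
apply: measurable_funM; first exact: measurable_cst.
apply: (@measurableT_comp _ _ _ _ _ _ (fun y : R => y `^ (-1))).
  exact: measurable_powR.
exact: measurable_row_of_enorm.
Qed.

HB.instance Definition _ N rho := isMeasurableFun.Build _ _ _ _
  (@radial_proj N rho) (@measurable_radial_proj N rho).

Lemma measurable_cball N (rho : R) :
  measurable [set t : RN N | enorm (row_of t) <= rho].
Proof.
rewrite -[X in measurable X]setTI.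
rewrite (_ : [set t | _] = (fun t : RN N => enorm (row_of t)) @^-1` `]-oo, rho]).
  by apply: measurable_row_of_enorm => //; exact: measurable_itv.
by apply/seteqP; split => t /=; rewrite in_itv.
Qed.

(* The surface measure on the sphere of radius [rho > 0] of R^N, as a measure
   on R^N carried by that sphere: [N / rho] times the Lebesgue measure of the
   part of the ball of radius [rho] that projects radially into the given set.
   The factor comes from integration in polar coordinates:
   |{t : |t| <= rho, rho t/|t| in A}|
     = \int_0^rho (r / rho)^(N-1) area(A) dr = (rho / N) area(A). *)
Definition sphere_area N (rho : R) : {measure set (RN N) -> \bar R} :=
  mscale `|N%:R / rho|%:nng
    (image_measure (mrestr (lebesgueN N) (@measurable_cball N rho))
       (@radial_proj N rho)).

Definition sphere N (rho : R) : set (RN N) :=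
  [set t | enorm (row_of t) = rho].

Definition upper_hemisphere n (rho : R) : set (RN n.+1) :=
  [set t | enorm (row_of t) = rho /\ 0 < last_coord (row_of t)].

Definition sigma_integrable (n : nat) (m : R) : Prop :=
  (sphere_area n.+1 1).-integrable (@upper_hemisphere n 1)
    (fun t => (last_coord (row_of t) `^ m)%:E).

Definition sigma (n : nat) (m : R) : R :=
  \int[sphere_area n.+1 1]_(t in @upper_hemisphere n 1)
     last_coord (row_of t) `^ m.

End SphereMeasure.

Arguments sphere {R} N rho.
Arguments upper_hemisphere {R} n rho.

(** Asymptotically Schwarzschild spaces *)

Section Asymptotics.
Context {R : realType} {n : nat} (X : smms R n) (phi : chart R n (smms_space X)).

(* [phi] is a diffeomorphism from the complement of a compact set onto the
   exterior region. *)
Definition end_diffeo : Prop :=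
  [/\ is_chart phi,
      exists2 K : set X, compact K & chart_dom phi = ~` K,
      chart_cod phi = exterior R n &
      forall c, @atlas _ _ X c -> compatible phi c].

(* Components of the pushforward of the metric under [phi]. *)
Definition push_metric (x : 'rV[R]_n.+1) : 'M[R]_n.+1 :=
  let c := chart_at (chart_point phi x) in
  pullback (overlap phi c) (transition phi c)
    (met X c (transition phi c x)) x.

Definition push_density (x : 'rV[R]_n.+1) : R := density (chart_point phi x).

(* f = O'(r ^ alpha), on the whole exterior region. *)
Definition bigO' (alpha : R) (f : 'rV[R]_n.+1 -> R) : Prop :=
  exists2 C : R, 0 < C & forall x, exterior R n x ->
    `|f x| <= C * enorm x `^ alpha /\
    forall i, has_partial (exterior R n) f i x /\
      `|partial (exterior R n) f i x| <= C * enorm x `^ (alpha - 1).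

Definition metric_error (a : R) (i j : 'I_n.+1) (x : 'rV[R]_n.+1) : R :=
  push_metric x i j - (1 + a * enorm x `^ (1 - n%:R - weight X)) * (i == j)%:R.

Definition asymptotically_Schwarzschild (a s : R) : Prop :=
  [/\ end_diffeo,
      0 < s < 1,
      forall i j, bigO' (s - n%:R - weight X) (metric_error a i j) &
      exists2 h, bigO' (s - n%:R - weight X) h & forall x, exterior R n x ->
        push_density x =
          (1 + a / 2 * enorm x `^ (1 - n%:R - weight X)) * last_coord x
          + last_coord x * h x].

Definition refined_metric_error (a s : R) : Prop :=
  exists (E0 : 'rV[R]_n.+1 -> R) (E1 : 'I_n.+1 -> 'I_n.+1 -> 'rV[R]_n.+1 -> R),
    [/\ bigO' (s - n%:R - weight X) E0,
        forall i j, bigO' (s - n%:R - weight X - 1) (E1 i j) &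
        forall i j x, exterior R n x ->
          metric_error a i j x = E0 x * (i == j)%:R + last_coord x * E1 i j x].

(** Mass *)

Definition metric_pert (i j : 'I_n.+1) (x : 'rV[R]_n.+1) : R :=
  push_metric x i j - (i == j)%:R.

Definition density_pert (x : 'rV[R]_n.+1) : R := push_density x - last_coord x.

Local Notation pd := (partial (exterior R n)).

Definition mass_form (i : 'I_n.+1) (x : 'rV[R]_n.+1) : R :=
  \sum_(j < n.+1) (pd (metric_pert i j) j x - pd (metric_pert j j) i x)
  + weight X * (last_coord x)^-1 * metric_pert ord_max i x
  - 2 * weight X * (last_coord x)^-1 * pd density_pert i x.

Definition bulk_integrand (x : 'rV[R]_n.+1) : R :=
  (\sum_(i < n.+1) mass_form i x * (x 0 i / enorm x))
  * last_coord x `^ weight X.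

(* The point (x_1, ..., x_n, t). *)
Definition append_coord (x : 'rV[R]_n) (t : R) : 'rV[R]_n.+1 :=
  \row_i (if unlift ord_max i is Some j then x 0 j else t).

Definition boundary_integrand (x : 'rV[R]_n) (t : R) : R :=
  let z := append_coord x t in
  (\sum_(k < n) metric_pert ord_max (lift ord_max k) z
     * (z 0 (lift ord_max k) / enorm z))
  * t `^ weight X.

Definition boundary_trace (x : 'rV[R]_n) : R :=
  lim (boundary_integrand x t @[t --> 0^'+]).

Definition flux_defined (rho : R) : Prop :=
  [/\ (sphere_area n.+1 rho).-integrable (upper_hemisphere n rho)
        (fun t => (bulk_integrand (row_of t))%:E),
      forall t, sphere n rho t ->
        cvg (boundary_integrand (row_of t) u @[u --> 0^'+]) &
      (sphere_area n rho).-integrable (sphere n rho)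
        (fun t => (boundary_trace (row_of t))%:E)].

Definition flux (rho : R) : R :=
  \int[sphere_area n.+1 rho]_(t in upper_hemisphere n rho)
     bulk_integrand (row_of t)
  + \int[sphere_area n rho]_(t in sphere n rho) boundary_trace (row_of t).

Definition mass_exists : Prop :=
  (\forall rho \near +oo, flux_defined rho) /\ cvg (flux rho @[rho --> +oo]).

Definition mass : R := lim (flux rho @[rho --> +oo]).

End Asymptotics.

(* Main.v *)
(** The flux integrand equals [(m + n) (m + n - 1) a r^(-n-m) x_(n+1)^m] up to an
    error [O(r^(s-n-1-nu)) x_(n+1)^nu] with [nu > -1], so scaling the sphere shows
    that the flux differs from its limit by [O(rho^(s-1))].

    For the independence of the coordinates, no asymptotics of the change of
    coordinates are needed: [|grad v|^2 - 1 = a p x_(n+1)^2 r^(p-2) + o(r^p)],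
    with [p = 1 - n - m < 0], is a scalar, hence so is [(|grad v|^2 - 1) v^(-p)],
    whose values near infinity are [a p t^(2-p) + o(1)], [t = x_(n+1) / r] in
    [(0, 1]]. Evaluating it along the axis [t = 1] of one chart and in the other
    chart gives [a = a' tau] for some [tau] in [[0, 1]], and conversely. *)
Require Import Defs.
From HB Require Import structures.
From mathcomp Require Import all_boot all_order all_algebra.
From mathcomp Require Import all_classical all_reals all_analysis.
From mathcomp Require Import measurable_realfun ring lra.

Set Implicit Arguments.
Unset Strict Implicit.
Unset Printing Implicit Defensive.

Import Order.TTheory GRing.Theory Num.Theory.
Import numFieldNormedType.Exports.

Local Open Scope classical_set_scope.
Local Open Scope ring_scope.

(** * Lebesgue measure on tuples *)

(** The obstacle in the flux is the factor [1 / x_(n+1)]: with the weight [x_(n+1)^m] it leaves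
    [x_(n+1)^(m-1)], integrable on the hemisphere for [m > 0] only. At [m = 0] its coefficient
    vanishes; for [m < 0] the refined error form supplies the missing factor. The boundary flux sees
    off-diagonal entries only: its trace is zero for [m <> 0] and [O(rho^(s-n))] for [m = 0],
    against an area of order [rho^(n-1)]. In the comparison of coordinates, a point on the axis of
    one chart has an uncontrolled direction in the other, so the asymptotics must be uniform up to
    [x_(n+1) = 0]; the positive exponent [-p] of [v] makes this possible. Its distance is controlled
    by [v] itself, which is bounded on compact sets and at most a multiple of [|y|]. The resulting
    relations hold up to [eps], with [tau] depending on [eps]; they give [|a| = |a'|], and opposite
    signs force both to vanish since [1 + tau >= 1]. *)

Section SigmaFiniteCopy.
Context d (T : measurableType d) (R : realType).
Variables (mu : {measure set T -> \bar R}) (mu_sf : sigma_finite [set: T] mu).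

(* [lebesgueN] is only a bundled measure; this copy carries the sigma-finite
   structure that Tonelli requires. *)
Definition sigma_finite_copy : set T -> \bar R := let _ := mu_sf in mu.

HB.instance Definition _ := Measure.copy sigma_finite_copy (Measure.sort mu).
HB.instance Definition _ :=
  Measure_isSigmaFinite.Build _ _ _ sigma_finite_copy mu_sf.

End SigmaFiniteCopy.

Section LebesgueN.
Context {R : realType}.
Local Notation RN N := (N.-tuple (measurableTypeR R)).

Lemma lebesgueN_S N (A : set (RN N.+1)) : lebesgueN N.+1 A =
  ((lebesgueN N \x lebesgue_measure)%E) (@cons_pair R N @^-1` A).
Proof. by []. Qed.

(** Cubes are products, so the recursion behind [lebesgueN] bounds their measure directly; they
    exhaust the space and contain the balls used later. *)
Definition cube N (r : R) : set (RN N) := [set t | forall i, `|tnth t i| <= r].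

Lemma measurable_cube N r : measurable (@cube N r).
Proof.
rewrite (_ : cube r = \bigcap_(i in [set: 'I_N])
    ((fun t : RN N => tnth t i) @^-1` [set y : measurableTypeR R | `|y| <= r])).
  apply: fin_bigcap_measurable => // i _; rewrite -[X in measurable X]setTI.
  apply: measurable_tnth => //.
  rewrite (_ : [set y | _] = `[-r, r]%classic); first exact: measurable_itv.
  by apply/seteqP; split => y /=; rewrite in_itv/= ler_norml.
by apply/seteqP; split => t /= h i => [_|]; exact: h.
Qed.

Lemma cons_pair_cube N r :
  @cons_pair R N @^-1` cube r = cube r `*` `[-r, r]%classic.
Proof.
apply/seteqP; split => -[t y]; rewrite /cube /=.
  move=> h; split => [i|]; last first.
    by rewrite in_itv/= -ler_norml; have := h ord0; rewrite tnth0.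
  by have := h (lift ord0 i); rewrite tnthS.
rewrite in_itv/= -ler_norml => -[h1 h2] i.
have [j ->|->] := unliftP ord0 i; first by rewrite tnthS.
by rewrite tnth0.
Qed.

Lemma lebesgueN_cube_lty N r : (lebesgueN N (cube r) < +oo)%E.
Proof.
elim: N => [|N IH]; first by rewrite /= diracE ltry.
rewrite lebesgueN_S cons_pair_cube product_measure1E//; last exact: measurable_cube.
rewrite lte_mul_pinfty// ?ge0_fin_numE//=.
by rewrite -/(lebesgue_measure _) lebesgue_measure_itv/=; case: ifP; rewrite ?ltry.
Qed.

Lemma sigma_finite_lebesgueN N : sigma_finite [set: RN N] (lebesgueN N).
Proof.
exists (fun k => cube k%:R).
  apply/esym; rewrite -subTset => t _.
  pose s := \sum_(i < N) `|tnth t i|.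
  exists (Num.truncn s).+1 => // i; apply: le_trans (ltW (truncnS_gt s)).
  by rewrite /s (bigD1 i)//= lerDl sumr_ge0.
by move=> k; split; [exact: measurable_cube|exact: lebesgueN_cube_lty].
Qed.

(** Tonelli for the recursion defining [lebesgueN]. The new coordinate is the head of the tuple, so
    the last coordinate, which carries the weight, is reached only in dimension one. *)
Lemma lebesgueN_integralS N (f : RN N.+1 -> \bar R) :
  measurable_fun setT f -> (forall t, (0 <= f t)%E) ->
  measurable_fun setT (fun t : RN N => \int[@lebesgue_measure R]_y f (cons_pair (t, y)))%E /\
  (\int[lebesgueN N.+1]_t f t =
   \int[lebesgueN N]_t \int[@lebesgue_measure R]_y f (cons_pair (t, y)))%E.
Proof.
move=> mf f0.
pose m1 : {sigma_finite_measure set (RN N) -> \bar R} :=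
  sigma_finite_copy (sigma_finite_lebesgueN N).
have mfc : measurable_fun setT (f \o @cons_pair R N).
  by apply: measurableT_comp => //; exact: measurable_cons_pair.
split.
  exact: (@measurable_fun_fubini_tonelli_F _ _ _ _ R lebesgue_measure
    (f \o @cons_pair R N) mfc (fun=> f0 _)).
transitivity (\int[(m1 \x (@lebesgue_measure R))%E]_z (f \o @cons_pair R N) z)%E.
  rewrite /= ge0_integral_pushforward//.
exact: (@fubini_tonelli1 _ _ _ _ R m1 lebesgue_measure (f \o @cons_pair R N) mfc (fun=> f0 _)).
Qed.

Lemma ge0_integral_mrestr d (T : measurableType d) (mu : {measure set T -> \bar R})
   (D : set T) (mD : measurable D) (f : T -> \bar R) :
  measurable_fun setT f -> (forall x, 0 <= f x)%E ->
  (\int[mrestr mu mD]_x f x = \int[mu]_(x in D) f x)%E.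
Proof.
move=> mf f0.
have mDC : measurable (~` D) by exact: measurableC.
rewrite [LHS](@ge0_negligible_integral _ _ _ _ _ (~` D))//; last first.
  by rewrite /= /mrestr setIC setICr measure0.
rewrite setDE setCK setTI; apply: eq_measure_integral => A mA AD.
by rewrite /= /mrestr setIidl.
Qed.

(** By uniqueness of Lebesgue measure: [c] times its image under multiplication by [c] gives every
    half-open interval its length. *)
Lemma integral_lebesgue_scale (c : R) (f : R -> \bar R) : 0 < c ->
  measurable_fun setT f -> (forall y, 0 <= f y)%E ->
  (\int[@lebesgue_measure R]_y f y =
   c%:E * \int[@lebesgue_measure R]_y f (c * y)%R)%E.
Proof.
move=> c0 mf f0.
pose h : measurableTypeR R -> measurableTypeR R := fun y => c * y.
have ms : measurable_fun setT h by exact: (@mulrl_measurable R setT c).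
pose sc : {mfun measurableTypeR R >-> measurableTypeR R} :=
  HB.pack h (isMeasurableFun.Build _ _ _ _ h ms).
pose mu := mscale (NngNum (ltW c0)) (image_measure (@lebesgue_measure R) sc).
transitivity (\int[mu]_y f y)%E.
  apply: eq_measure_integral => A mA _; apply: lebesgue_measure_unique => //.
  move=> X [[a b] _ <-].
  have Esc : h @^-1` `]a, b] = `]a / c, b / c]%classic.
    by apply/seteqP; split => y; rewrite /= /h !in_itv/= [c * y]mulrC ltr_pdivrMr// ler_pdivlMr.
  transitivity (c%:E * lebesgue_measure (h @^-1` `]a, b]%classic))%E => //.
  rewrite Esc !lebesgue_measure_itv/= !lte_fin ltr_pM2r ?invr_gt0//.
  case: ifP => _; last by rewrite mule0.
  by rewrite -!EFinD -EFinM -mulrBl mulrC divfK ?gt_eqF.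
rewrite ge0_integral_mscale//=; congr (_ * _)%E.
by rewrite ge0_integral_pushforward.
Qed.

Definition scale_tuple N (c : R) (t : RN N) : RN N := [tuple c * tnth t i | i < N].

Lemma measurable_scale_tuple N c : measurable_fun setT (@scale_tuple N c).
Proof.
apply/measurable_fun_tnthP => i.
rewrite [X in measurable_fun _ X](_ : _ = (fun t : RN N => c * tnth t i)); last first.
  by apply/funext => t /=; rewrite tnth_mktuple.
by apply: measurable_funM; [exact: measurable_cst|exact: measurable_tnth].
Qed.

Lemma scale_cons_pair N c (t : RN N) y :
  scale_tuple c (cons_pair (t, y)) = cons_pair (scale_tuple c t, c * y).
Proof.
apply: eq_from_tnth => i; rewrite tnth_mktuple /cons_pair/=.
by have [j ->|->] := unliftP ord0 i; rewrite ?tnthS ?tnth0// tnth_mktuple.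
Qed.

Lemma integral_lebesgueN_scale N (c : R) (f : RN N -> \bar R) : 0 < c ->
  measurable_fun setT f -> (forall t, 0 <= f t)%E ->
  (\int[lebesgueN N]_t f t =
   (c ^+ N)%:E * \int[lebesgueN N]_t f (scale_tuple c t))%E.
Proof.
move=> c0; elim: N f => [|N IH] f mf f0.
  rewrite expr0 mul1e; apply: eq_integral => t _.
  by congr f; apply: eq_from_tnth => -[].
have mfs : measurable_fun setT (f \o @scale_tuple N.+1 c).
  by apply: measurableT_comp => //; exact: measurable_scale_tuple.
have [mF ->] := lebesgueN_integralS mf f0.
have [mG ->] := lebesgueN_integralS mfs (fun t => f0 (scale_tuple c t)).
have F0 t : (0 <= \int[@lebesgue_measure R]_y f (cons_pair (t, y)))%E.
  exact: integral_ge0.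
have G0 t : (0 <= \int[@lebesgue_measure R]_y f (scale_tuple c (cons_pair (t, y))))%E.
  exact: integral_ge0.
rewrite IH// exprS EFinM muleAC [RHS]muleC; congr (_ * _)%E.
rewrite -ge0_integralZl//; last by rewrite lee_fin ltW.
apply: eq_integral => t _; rewrite (integral_lebesgue_scale c0)//.
- by under eq_integral do rewrite -scale_cons_pair.
- apply: measurableT_comp => //.
  exact: (measurableT_comp (@measurable_cons_pair R N) (pair1_measurable (scale_tuple c t))).
by move=> t _; exact: G0.
Qed.

End LebesgueN.

(** * Integrals over spheres *)

Section Powers.
Context {R : realType}.

Lemma derive_pow_primitive (mu x : R) : 0 < mu + 1 -> 0 < x ->
  is_derive x 1 (fun y : R => (mu + 1)^-1 * y `^ (mu + 1)) (x `^ mu).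
Proof.
move=> mu1 x0.
have H := is_derive1_powR (mu + 1) x0.
have -> : (fun y : R => (mu + 1)^-1 * y `^ (mu + 1)) =
  (mu + 1)^-1 *: (fun y : R => y `^ (mu + 1)) by apply/funext.
apply: is_derive_eq.
by rewrite /GRing.scale/= mulrA mulVf ?mul1r ?gt_eqF// addrK.
Qed.

(** The fundamental theorem of calculus bounds the integral over [[1/(k+2), 1]] by [1 / (mu + 1)]
    for every [k], and monotone convergence removes the cut-off at the singularity 0. *)
Lemma integral_power_lty (mu : R) : -1 < mu ->
  (\int[@lebesgue_measure R]_(y in `]0%R, 1%R]) (y `^ mu)%:E < +oo)%E.
Proof.
move=> mu1; have mu10 : 0 < mu + 1 by lra.
(* The index [k + 2] keeps the interval nondegenerate already at [k = 0]. *)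
pose D k : set R := `[k.+2%:R^-1, 1]%classic.
have k0 k : 0 < k.+2%:R^-1 :> R by rewrite invr_gt0.
have k1 k : k.+2%:R^-1 < 1 :> R by rewrite invf_lt1// ltr1n.
have UD : \bigcup_k D k = `]0%R, 1%R]%classic.
  apply/seteqP; split => y /=.
    move=> [k _]; rewrite /D /= !in_itv/= => /andP[ky ->]; rewrite andbT.
    exact: lt_le_trans ky.
  rewrite !in_itv/= => /andP[y0 y1].
  exists (Num.truncn y^-1) => //; rewrite /D /= in_itv/= y1 andbT.
  rewrite invf_ple ?posrE//; apply/ltW/(lt_le_trans (truncnS_gt _)).
  by rewrite ler_nat.
have mf : measurable_fun setT (fun y : R => (y `^ mu)%:E).
  by apply/measurable_EFinP; exact: measurable_powR.
have ndD : {homo D : k l / (k <= l)%N >-> (k <= l)%O}.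
  move=> k l kl; apply/subsetPset => y; rewrite /D /= !in_itv/= => /andP[ky ->].
  by rewrite andbT; apply: le_trans ky; rewrite lef_pV2 ?posrE// ler_nat !ltnS.
have cvgI : (\int[@lebesgue_measure R]_(y in D k) (y `^ mu)%:E)%E @[k --> \oo] -->
    (\int[@lebesgue_measure R]_(y in \bigcup_k D k) (y `^ mu)%:E)%E.
  apply: ge0_nondecreasing_set_cvg_integral => //.
  - by move=> k; exact: measurable_itv.
  - by move=> k; exact: measurable_funTS.
  - by move=> k y _; rewrite lee_fin powR_ge0.
rewrite -UD; apply: (@le_lt_trans _ _ ((mu + 1)^-1)%:E); last by rewrite ltry.
rewrite -(cvg_lim _ cvgI)//; apply: lime_le; first exact: cvgP cvgI.
apply: nearW => k.
pose F (y : R) : R := (mu + 1)^-1 * y `^ (mu + 1).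
have dF y : 0 < y -> derivable F y 1 by move=> /(derive_pow_primitive mu10)[].
have cF y : 0 < y -> {for y, continuous F}.
  by move=> y0; exact/differentiable_continuous/derivable1_diffP/dF.
rewrite (@continuous_FTC2 _ _ F)//.
- rewrite -EFinB lee_fin /F powR1 mulr1 gerBl mulr_ge0 ?powR_ge0//.
  by rewrite invr_ge0 ltW.
- apply: continuous_in_subspaceT => y; rewrite inE/= in_itv/= => /andP[ky _].
  apply/differentiable_continuous/derivable1_diffP/derivable_powR.
  by rewrite in_itv/= andbT (lt_le_trans (k0 k) ky).
- split.
  + by move=> y; rewrite in_itv/= => /andP[ky _]; apply: dF; exact: lt_trans ky.
  + exact/cvg_at_right_filter/cF.
  + exact/cvg_at_left_filter/cF.
- move=> y; rewrite in_itv/= => /andP[ky _]; rewrite derive1E.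
  by have [_ ->] := derive_pow_primitive mu10 (lt_trans (k0 k) ky).
Qed.

End Powers.

Section SphereIntegrals.
Context {R : realType}.
Local Notation RN N := (N.-tuple (measurableTypeR R)).

Lemma last_coord_row_of N (t : RN N.+1) : last_coord (row_of t) = tnth t ord_max.
Proof. by rewrite /last_coord mxE. Qed.

Lemma measurable_last_coord N :
  measurable_fun setT (fun t : RN N.+1 => last_coord (row_of t)).
Proof.
under eq_fun do rewrite last_coord_row_of; exact: (@measurable_tnth _ (measurableTypeR R) N.+1 ord_max).
Qed.

Lemma enorm_ge0 N (x : 'rV[R]_N) : 0 <= enorm x.
Proof. exact: sqrtr_ge0. Qed.

Lemma enorm_sq N (x : 'rV[R]_N) : enorm x ^+ 2 = \sum_i x 0 i ^+ 2.
Proof. by rewrite sqr_sqrtr// sumr_ge0// => i _; exact: sqr_ge0. Qed.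

Lemma coord_le_enorm N (x : 'rV[R]_N) i : `|x 0 i| <= enorm x.
Proof.
rewrite -sqrtr_sqr; apply: ler_wsqrtr; rewrite (bigD1 i)//= lerDl.
by rewrite sumr_ge0// => j _; exact: sqr_ge0.
Qed.

Lemma enorm_scale_tuple N c (t : RN N) : 0 <= c ->
  enorm (row_of (scale_tuple c t)) = c * enorm (row_of t).
Proof.
move=> c0; rewrite /enorm -{2}(ger0_norm c0) -sqrtr_sqr -sqrtrM ?sqr_ge0//.
congr Num.sqrt; rewrite mulr_sumr; apply: eq_bigr => i _.
by rewrite !mxE tnth_mktuple exprMn.
Qed.

Lemma sphere_area_integral N (rho : R) (F : RN N -> \bar R) : 0 < rho ->
  measurable_fun setT F -> (forall t, 0 <= F t)%E ->
  (\int[sphere_area N rho]_t F t = (N%:R / rho)%:E *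
    \int[lebesgueN N]_(t in [set t : RN N | (enorm (row_of t) <= rho)%R])
      F (radial_proj rho t))%E.
Proof.
move=> rho0 mF F0; rewrite /sphere_area ge0_integral_mscale//=.
rewrite ger0_norm ?divr_ge0 ?(ltW rho0)//; congr (_ * _)%E.
rewrite ge0_integral_pushforward// preimage_setT ge0_integral_mrestr//;
  last by move=> t; exact: F0.
by apply: measurableT_comp => //; exact: measurable_radial_proj.
Qed.

(** The dilation contributes [rho^(N+1)] in dimension [N + 1], of which the factor [1 / rho] in the
    normalisation of [sphere_area] takes one power. *)
Lemma sphere_area_scale N (rho : R) (F : RN N.+1 -> \bar R) : 0 < rho ->
  measurable_fun setT F -> (forall t, 0 <= F t)%E ->
  (\int[sphere_area N.+1 rho]_t F t =
   (rho ^+ N)%:E * \int[sphere_area N.+1 1]_t F (scale_tuple rho t))%E.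
Proof.
move=> rho0 mF F0.
have mFs : measurable_fun setT (F \o @scale_tuple R N.+1 rho).
  by apply: measurableT_comp => //; exact: measurable_scale_tuple.
rewrite !sphere_area_integral// divr1 integral_mkcond [in RHS]integral_mkcond.
have mB (r : R) := @measurable_cball R N.+1 r.
have mr (r : R) := @measurable_radial_proj R N.+1 r.
have mG : measurable_fun setT ((fun t : RN N.+1 => F (radial_proj rho t)) \_
    [set t : RN N.+1 | (enorm (row_of t) <= rho)%R]).
  by apply/(measurable_restrictT _ (mB rho))/measurable_funTS; exact: measurableT_comp.
rewrite (integral_lebesgueN_scale rho0)//; last by move=> t; rewrite patchE; case: ifP.
rewrite muleA -EFinM muleA -EFinM; congr (_%:E * _)%E.
  by rewrite exprS; field; rewrite gt_eqF.
apply: eq_integral => t _; rewrite !patchE.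
have -> : (scale_tuple rho t \in [set t : RN N.+1 | (enorm (row_of t) <= rho)%R]) =
    (t \in [set t : RN N.+1 | (enorm (row_of t) <= 1)%R]).
  by apply/idP/idP; rewrite !inE/= enorm_scale_tuple ?(ltW rho0)// ger_pMr.
case: ifP => // _; congr F; apply: eq_from_tnth => i.
rewrite !tnth_mktuple enorm_scale_tuple ?(ltW rho0)// invfM.
(* At the origin the inverse of the norm is 0 by convention, so both radial projections vanish
   there. *)
have [->|e0] := eqVneq (enorm (row_of t)) 0; first by rewrite invr0 !(mulr0,mul0r).
by field; rewrite e0 gt_eqF.
Qed.

Lemma tnth_max_cons N (t : RN N.+1) y :
  tnth (cons_pair (t, y)) ord_max = tnth t ord_max.
Proof.
by rewrite (_ : ord_max = lift ord0 ord_max) ?tnthS//; exact: val_inj.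
Qed.

(** The integrand ignores the head coordinates, so each one that is peeled off contributes the
    factor 2, the length of [[-1, 1]], until only the last coordinate is left. *)
Lemma integral_cube_last_lty N (g : R -> \bar R) :
  measurable_fun setT g -> (forall y, 0 <= g y)%E ->
  (\int[@lebesgue_measure R]_y g y < +oo)%E ->
  (\int[lebesgueN N.+1]_(t in cube 1) g (tnth t ord_max) < +oo)%E.
Proof.
move=> mg g0 gy; rewrite integral_mkcond.
have mt k : measurable_fun setT (fun t : RN k.+1 => tnth t ord_max : R).
  exact: (@measurable_tnth _ (measurableTypeR R) k.+1 ord_max).
have mf k : measurable_fun setT
    ((fun t : RN k.+1 => g (tnth t ord_max)) \_ (cube 1)).
  apply/(measurable_restrictT _ (@measurable_cube _ _ _))/measurable_funTS.
  exact: (measurableT_comp mg (mt k)).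
have f0 k t : (0 <= ((fun t : RN k.+1 => g (tnth t ord_max)) \_ (cube 1)) t)%E.
  by rewrite patchE; case: ifP.
elim: N => [|N IH].
  have [mF ->] := lebesgueN_integralS (mf 0%N) (f0 0%N).
  apply: (@le_lt_trans _ _
    (\int[lebesgueN 0]_t \int[@lebesgue_measure R]_y g y)%E).
    apply: ge0_le_integral => //.
      by move=> t _; exact: integral_ge0.
    move=> t _; apply: ge0_le_integral => //.
      apply: measurableT_comp; first exact: mf.
      exact: (measurableT_comp (@measurable_cons_pair R 0) (pair1_measurable t)).
    move=> y _ /=; rewrite patchE; case: ifP => _ //.
  by rewrite integral_cst//= diracT mule1.
have [mF ->] := lebesgueN_integralS (mf N.+1) (f0 N.+1).
under eq_integral => t _.
  rewrite (_ : (\int[_]_y _)%E =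
    (2%:E * ((fun t : RN N.+1 => g (tnth t ord_max)) \_ (cube 1)) t)%E); last first.
    rewrite (_ : (fun y => _) =
        (fun y => ((fun t : RN N.+1 => g (tnth t ord_max)) \_ (cube 1)) t * (\1_(`[-1, 1]%classic : set R) y)%:E)%E); last first.
      apply/funext => y; rewrite !patchE indicE tnth_max_cons.
      have -> : (cons_pair (t, y) \in cube 1) = (t \in cube 1) && (y \in `[-1, 1]%classic).
        transitivity ((t, y) \in cube 1 `*` `[-1, 1]%classic); last by rewrite in_setX.
        by rewrite -cons_pair_cube.
      by case: (t \in _); case: (y \in _) => /=; rewrite ?mule1 ?mule0 ?mul0e.
    rewrite ge0_integralZl//; last first.
      by apply/measurable_EFinP; exact: measurable_indic.
    rewrite integral_indic//= setIT -/(lebesgue_measure _) lebesgue_measure_itv/= lte_fin.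
    by rewrite ifT; [rewrite -EFinB muleC; congr (_%:E * _)%E; ring|lra].
  over.
rewrite ge0_integralZl//; last exact: mf.
by rewrite lte_mul_pinfty.
Qed.

Lemma measurable_upper_hemisphere N (rho : R) : measurable (@upper_hemisphere R N rho).
Proof.
rewrite (_ : upper_hemisphere N rho =
  ((fun t : RN N.+1 => enorm (row_of t)) @^-1` [set rho]) `&`
  ((fun t : RN N.+1 => last_coord (row_of t)) @^-1` `]0%R, +oo[)); last first.
  by apply/seteqP; split => t /=; rewrite in_itv/= andbT.
apply: measurableI; rewrite -[X in measurable X]setTI.
  exact: measurable_row_of_enorm.
exact: measurable_last_coord.
Qed.

Lemma measurable_sphere N (rho : R) : measurable (@sphere R N rho).
Proof.
rewrite -[X in measurable X]setTI.
exact: (@measurable_row_of_enorm R N measurableT [set rho]).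
Qed.

(** Pulled back to the unit ball, the integrand is a power of [t_last / |t|], which involves all
    coordinates. Since [t_last <= t_last / |t| <= 1], replacing the exponent by [min mu 0] and then
    the quotient by [t_last] only increases it, and leaves a function of the last coordinate on the
    cube. *)
Lemma hemisphere_power_lty N (mu : R) : -1 < mu ->
  (\int[sphere_area N.+1 1]_(t in upper_hemisphere N 1)
     (last_coord (row_of t) `^ mu)%:E < +oo)%E.
Proof.
move=> mu1.
have mp (k : R) : measurable_fun setT
    (fun t : RN N.+1 => (last_coord (row_of t) `^ k)%:E).
  apply/measurable_EFinP.
  exact: (measurableT_comp (@measurable_powR R k) (@measurable_last_coord N)).
have mH := @measurable_upper_hemisphere N 1.
pose k := Num.min mu 0.
have k1 : -1 < k by rewrite lt_min mu1/=; lra.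
have k0 : k <= 0 by rewrite ge_min lexx orbT.
have kmu : k <= mu by rewrite ge_min lexx.
rewrite integral_mkcond sphere_area_integral//; last 2 first.
- by apply/(measurable_restrictT _ mH)/measurable_funTS.
- by move=> t; rewrite patchE; case: ifP => //; rewrite lee_fin powR_ge0.
rewrite lte_mul_pinfty ?lee_fin ?divr_ge0//.
pose g (y : R) : \bar R := ((fun y => (y `^ k)%:E) \_ `]0%R, 1%R]) y.
have mg : measurable_fun setT g.
  apply/(measurable_restrictT _ (measurable_itv _))/measurable_funTS.
  by apply/measurable_EFinP; exact: measurable_powR.
have g0 y : (0 <= g y)%E by rewrite /g patchE; case: ifP => // _; rewrite lee_fin powR_ge0.
have := @integral_cube_last_lty N g mg g0.
rewrite -integral_mkcond => /(_ (integral_power_lty k1)).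
apply: le_lt_trans; rewrite integral_mkcond [leRHS]integral_mkcond.
apply: ge0_le_integral => //.
- by move=> t _; rewrite !patchE; case: ifP => // _; case: ifP => // _; rewrite lee_fin powR_ge0.
- apply/(measurable_restrictT _ (@measurable_cball R N.+1 1))/measurable_funTS.
  apply: measurableT_comp; last exact: measurable_radial_proj.
  by apply/(measurable_restrictT _ mH)/measurable_funTS.
- apply/(measurable_restrictT _ (@measurable_cube _ _ _))/measurable_funTS.
  apply: (measurableT_comp mg).
  exact: (@measurable_tnth _ (measurableTypeR R) N.+1 ord_max).
- move=> t _; rewrite patchE [leRHS]patchE.
  have [/set_mem/= t1|_] := boolP (t \in [set t : RN N.+1 | (enorm (row_of t) <= 1)%R]);
    last by case: ifP.
  rewrite ifT; last first.
    rewrite inE => i; apply: le_trans t1.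
    by have := coord_le_enorm (row_of t) i; rewrite mxE.
  rewrite patchE; case: ifPn => [/set_mem [e1]|_]; last exact: g0.
  rewrite !last_coord_row_of tnth_mktuple => l0.
  have tn0 : 0 < enorm (row_of t).
    rewrite lt_neqAle enorm_ge0 andbT; apply: contraTneq l0 => <-.
    by rewrite invr0 mulr0 mul0r ltxx.
  have t0 : 0 < tnth t ord_max by move: l0; rewrite pmulr_rgt0// divr_gt0.
  have tle : tnth t ord_max <= enorm (row_of t).
    by apply: le_trans (coord_le_enorm _ ord_max); rewrite mxE ler_norm.
  rewrite /g patchE ifT; last by rewrite inE/= in_itv/= t0 (le_trans tle).
  set x := 1 / _ * _ in l0 *.
  have x1 : x <= 1 by rewrite /x mul1r mulrC ler_pdivrMr// mul1r.
  have tx : tnth t ord_max <= x.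
    by rewrite /x mul1r ler_peMl ?(ltW t0)// invf_ge1.
  rewrite lee_fin; apply: (@le_trans _ _ (x `^ k)).
    by apply: ger_powR => //; rewrite l0.
  rewrite -[k]opprK !(powRN _ (- k)) lef_pV2 ?posrE ?powR_gt0//.
  by apply: ge0_ler_powR; rewrite ?nnegrE ?oppr_ge0// ltW.
Qed.

Lemma hemisphere_power_scale N (mu rho : R) : 0 < rho ->
  (\int[sphere_area N.+1 rho]_(t in upper_hemisphere N rho)
     (last_coord (row_of t) `^ mu)%:E =
   (rho `^ (N%:R + mu))%:E * \int[sphere_area N.+1 1]_(t in upper_hemisphere N 1)
     (last_coord (row_of t) `^ mu)%:E)%E.
Proof.
move=> rho0.
have mH r := @measurable_upper_hemisphere N r.
have mp r : measurable_fun setT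
    ((fun t : RN N.+1 => (last_coord (row_of t) `^ mu)%:E) \_ (upper_hemisphere N r)).
  apply/(measurable_restrictT _ (mH r))/measurable_funTS/measurable_EFinP.
  exact: (measurableT_comp (@measurable_powR R mu) (@measurable_last_coord N)).
have p0 r t : (0 <= ((fun t : RN N.+1 => (last_coord (row_of t) `^ mu)%:E)
    \_ (upper_hemisphere N r)) t)%E.
  by rewrite patchE; case: ifP => // _; rewrite lee_fin powR_ge0.
rewrite [LHS]integral_mkcond (sphere_area_scale rho0 (mp rho) (p0 rho)).
rewrite [in RHS]integral_mkcond.
have -> : (rho `^ (N%:R + mu))%:E = ((rho ^+ N)%:E * (rho `^ mu)%:E)%E.
  rewrite powRD ?(gt_eqF rho0) ?implybT//.
  by rewrite powR_mulrn ?(ltW rho0)// EFinM.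
rewrite -[RHS]muleA; apply: (congr1 (mule _)).
rewrite -ge0_integralZl//; last by rewrite lee_fin powR_ge0.
apply: eq_integral => t _; rewrite !patchE.
have -> : (scale_tuple rho t \in upper_hemisphere N rho) = (t \in upper_hemisphere N 1).
  apply/idP/idP; rewrite !inE /upper_hemisphere/= enorm_scale_tuple ?(ltW rho0)//;
    rewrite !last_coord_row_of tnth_mktuple pmulr_rgt0// => -[h ->]; split=> //.
    by apply: (mulfI (lt0r_neq0 rho0)); rewrite h mulr1.
  by rewrite h mulr1.
case: ifPn => [/set_mem [_]|_]; last by rewrite mule0.
rewrite !last_coord_row_of tnth_mktuple => t0.
by rewrite -EFinM powRM// ltW.
Qed.

Lemma sphere_total_scale N (rho : R) : 0 < rho ->
  (\int[sphere_area N.+1 rho]_(t in sphere N.+1 rho) 1%:E = (rho ^+ N)%:E *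
   \int[sphere_area N.+1 1]_(t in sphere N.+1 1) 1%:E)%E /\
  (\int[sphere_area N.+1 1]_(t in sphere N.+1 1) 1%:E < +oo :> \bar R)%E.
Proof.
move=> rho0.
have mS r := @measurable_sphere N.+1 r.
have m1 r : measurable_fun setT ((fun _ : RN N.+1 => 1%:E : \bar R) \_ (sphere N.+1 r)).
  by apply/(measurable_restrictT _ (mS r)).
have p0 r t : (0 <= ((fun _ : RN N.+1 => 1%:E : \bar R) \_ (sphere N.+1 r)) t)%E.
  by rewrite patchE; case: ifP => // _; rewrite lee_fin ler01.
split.
  rewrite [LHS]integral_mkcond (sphere_area_scale rho0 (m1 rho) (p0 rho)).
  rewrite [in RHS]integral_mkcond; congr (_ * _)%E.
  apply: eq_integral => t _; rewrite !patchE.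
  have -> // : (scale_tuple rho t \in sphere N.+1 rho) = (t \in sphere N.+1 1).
  apply/idP/idP; rewrite !inE /sphere/= enorm_scale_tuple ?(ltW rho0)// => h.
    by apply: (mulfI (lt0r_neq0 rho0)); rewrite h mulr1.
  by rewrite h mulr1.
rewrite integral_mkcond sphere_area_integral// lte_mul_pinfty ?lee_fin ?divr_ge0//.
apply: le_lt_trans (lebesgueN_cube_lty N.+1 1).
have -> : (lebesgueN N.+1 (cube 1) = \int[lebesgueN N.+1]_(t in cube 1) (1 : R)%:E)%E.
  by rewrite (integral_cst (lebesgueN N.+1) (@measurable_cube R N.+1 1) 1%:E) mul1e.
rewrite integral_mkcond [leRHS]integral_mkcond; apply: ge0_le_integral => //.
- by move=> t _; rewrite patchE; case: ifP.
- apply/(measurable_restrictT _ (@measurable_cball R N.+1 1))/measurable_funTS.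
  by apply: measurableT_comp; last exact: measurable_radial_proj.
- by apply/(measurable_restrictT _ (@measurable_cube _ _ _)).
- move=> t _; rewrite patchE [leRHS]patchE.
  have [/set_mem/= t1|_] := boolP (t \in [set t : RN N.+1 | (enorm (row_of t) <= 1)%R]);
    last by case: ifP.
  rewrite ifT; last first.
    rewrite inE => i; apply: le_trans t1.
    by have := coord_le_enorm (row_of t) i; rewrite mxE.
  by rewrite patchE; case: ifP.
Qed.

End SphereIntegrals.

(** * Partial derivatives at interior points *)

Lemma cvg_row (R : realType) (N : nat) (T : Type) (F : set_system T)
    {FF : Filter F} (g : T -> 'rV[R]_N) (x : 'rV[R]_N) :
  (forall i, g t 0 i @[t --> F] --> x 0 i) -> g t @[t --> F] --> x.
Proof.
move=> gx; apply/cvg_ballP => e e0.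
have : \forall t \near F, forall i, ball (x 0 i) e (g t 0 i).
  by apply: filter_forall => i; have /cvg_ballP/(_ _ e0) := gx i.
by apply: filterS => t gt; split=> // i0 i; rewrite (ord1 i0).
Qed.

Section Interior.
Context {R : realType} {N : nat}.
Implicit Types (D : set 'rV[R]_N) (f : 'rV[R]_N -> R) (i : 'I_N) (x : 'rV[R]_N).
Local Notation e_ i := (delta_mx 0 i : 'rV[R]_N).

Lemma line_cvg x v : x + h *: v @[h --> (0:R)] --> x.
Proof.
rewrite -[X in _ --> X]addr0 -[in X in _ --> X](scale0r v).
apply: cvgD; first exact: cvg_cst.
by apply: cvgZr_tmp; exact: cvg_id.
Qed.

Lemma increments_interior D i x : nbhs x D -> increments D i x = (0 : R)^'.
Proof.
move=> xD; rewrite /increments.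
have H : \forall h \near (0 : R)^', D (x + h *: e_ i).
  have : nbhs (0 : R) [set h | D (x + h *: e_ i)] := @line_cvg x (e_ i) _ xD.
  exact: cvg_within.
apply/seteqP; split => A; rewrite /within/= => AP.
  by near=> h; apply: (near AP h) => //; exact: (near H h).
by near=> h => _; exact: (near AP h).
Unshelve. all: by end_near. Qed.

Lemma diff_quotientE f i x : diff_quotient f i x =
  (fun h => h^-1 *: ((f \o shift x) (h *: e_ i) - f x)).
Proof. by apply/funext => h; rewrite /diff_quotient /= [_ + x]addrC. Qed.

Lemma partial_interior D f i x : nbhs x D -> partial D f i x = 'D_(e_ i) f x.
Proof. by move=> xD; rewrite /partial increments_interior// diff_quotientE. Qed.

Lemma has_partial_interior D f i x : nbhs x D ->
  has_partial D f i x <-> derivable f x (e_ i).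
Proof. by move=> xD; rewrite /has_partial increments_interior// diff_quotientE. Qed.

Lemma is_derive_line f x v t d : is_derive (x + t *: v) v f d ->
  is_derive t 1 (fun t => f (x + t *: v)) d.
Proof.
move=> [df fd].
have E : (fun h : R => h^-1 *: (((fun t => f (x + t *: v)) \o shift t) (h *: 1)
    - f (x + t *: v))) =
  (fun h => h^-1 *: ((f \o shift (x + t *: v)) (h *: v) - f (x + t *: v))).
  apply/funext => h /=; congr (_ *: (f _ - _)).
  rewrite (_ : h *: (1 : R) = h); last exact: mulr1.
  by rewrite scalerDl addrCA.
by split; rewrite /derivable /derive E.
Qed.

(** The mean value theorem with a reference slope [c]. Both signs of [d] are covered, since it is
    applied to coordinate increments. *)
Lemma segment_estimate (g : R -> R) (c e d : R) :
  (forall t, `|t| <= `|d| -> derivable g t 1 /\ `|'D_1 g t - c| <= e) ->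
  `|g d - g 0 - c * d| <= e * `|d|.
Proof.
move=> H.
have cg t : `|t| <= `|d| -> {for t, continuous g}.
  by move=> /H[dg _]; exact/differentiable_continuous/derivable1_diffP.
have [d0|d0] := leP 0 d.
  have [] := @MVT_segment R g (fun t => 'D_1 g t) 0 d d0.
  - move=> t; rewrite in_itv/= => /andP[t0 td]; apply: DeriveDef => //.
    by apply: (H t _).1; rewrite !ger0_norm// ltW.
  - apply: continuous_in_subspaceT => t; rewrite inE/= in_itv/= => /andP[t0 td].
    by apply: cg; rewrite !ger0_norm.
  - move=> t; rewrite in_itv/= subr0 => /andP[t0 td] ->.
    rewrite -mulrBl normrM ler_wpM2r//; apply: (H t _).2; by rewrite !ger0_norm.
have [] := @MVT_segment R g (fun t => 'D_1 g t) d 0 (ltW d0).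
- move=> t; rewrite in_itv/= => /andP[t0 td]; apply: DeriveDef => //.
  by apply: (H t _).1; rewrite !ltr0_norm// lerN2 ltW.
- apply: continuous_in_subspaceT => t; rewrite inE/= in_itv/= => /andP[t0 td].
  by apply: cg; rewrite (ler0_norm td) ltr0_norm// lerN2.
- move=> t; rewrite in_itv/= sub0r => /andP[t0 td] E.
  rewrite -[g d - g 0]opprB E mulrN opprK -mulrBl normrM ler_wpM2r//; apply: (H t _).2.
  by rewrite (ler0_norm td) ltr0_norm// lerN2.
Qed.

(** The passage from [x] to [y] changes one coordinate at a time; the intermediate points stay in
    the ball because it is a ball of the sup norm. With [c = 0] the estimate yields continuity, with
    [c] the partials at [x] it yields first-order approximation. *)
Lemma partials_estimate f x (c : 'I_N -> R) (e r : R) :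
  (forall y, ball x r y -> forall i,
     derivable f y (e_ i) /\ `|'D_(e_ i) f y - c i| <= e) ->
  forall y, ball x r y ->
    `|f y - f x - \sum_i c i * (y 0 i - x 0 i)| <= e * \sum_i `|y 0 i - x 0 i|.
Proof.
move=> H y xy.
pose q (j : nat) : 'rV[R]_N := \row_i (if (i < j)%N then y 0 i else x 0 i).
have q0 : q 0%N = x by apply/rowP => i; rewrite mxE.
have qN : q N = y by apply/rowP => i; rewrite mxE ltn_ord.
have qS (j : 'I_N) : q j.+1 = q j + (y 0 j - x 0 j) *: e_ j.
  apply/rowP => i; rewrite !mxE ltnS leq_eqVlt eqxx/= -[(i == j :> nat)]/(i == j).
  by case: eqVneq => [->|ij] /=; rewrite ?ltnn ?mulr1 ?mulr0 ?addr0// addrC subrK.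
rewrite -{1}qN -{1}q0 -(telescope_sumr (fun j => f (q j)))// big_mkord -sumrB.
apply: le_trans (ler_norm_sum _ _ _) _; rewrite mulr_sumr; apply: ler_sum => j _.
have := @segment_estimate (fun t => f (q j + t *: e_ j)) (c j) e (y 0 j - x 0 j).
rewrite -qS scale0r addr0; apply => t tj.
have xq : ball x r (q j + t *: e_ j).
  split=> [|i0 i]; first exact: xy.1.
  rewrite !mxE (ord1 i0) eqxx/= -ball_normE/=.
  have := xy.2 0 i; rewrite -ball_normE/= => xyi.
  have [ij|ij] := eqVneq i j.
    rewrite ij ltnn mulr1 opprD addrA subrr sub0r normrN; apply: le_lt_trans tj _.
    by rewrite distrC -ij.
  rewrite mulr0 addr0; case: ifP => // _; rewrite subrr normr0.
  exact: le_lt_trans xyi.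
have [dq Dq] := H _ xq j.
have [d1 ->] := is_derive_line (DeriveDef dq erefl).
by split.
Qed.

(** The asymptotic conditions bound partial derivatives only; this recovers from them the continuity
    on which measurability rests. *)
Lemma bounded_partials_continuous f x (C : R) (U : set 'rV[R]_N) : nbhs x U ->
  (forall y, U y -> forall i, derivable f y (e_ i) /\ `|'D_(e_ i) f y| <= C) ->
  {for x, continuous f}.
Proof.
move=> /nbhs_ballP[r/= r0 rU] H.
have est y : ball x r y -> `|f y - f x| <= C * \sum_i `|y 0 i - x 0 i|.
  move=> xy; have := @partials_estimate f x (fun=> 0) C r.
  move=> /(_ _ y xy); rewrite big1 ?subr0//; last by move=> i _; rewrite mul0r.
  apply => z /rU zU i; have [d b] := H z zU i; split => //.
  by rewrite subr0.
apply/(@cvgrPdist_le _ _ _ _ (nbhs_filter x)) => /= e e0.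
pose K := `|C| * N%:R + 1.
have K0 : 0 < K by rewrite /K; apply: ltr_wpDl => //; exact: mulr_ge0.
have r1 : 0 < Num.min r (e / K) by rewrite lt_min r0 divr_gt0.
near=> y; have xy : ball x (Num.min r (e / K)) y by near: y; exact: nbhsx_ballx.
rewrite distrC; apply: le_trans (est y _) _.
  by apply: le_ball xy; rewrite ge_min lexx.
apply: (@le_trans _ _ (`|C| * \sum_(i < N) (e / K))).
  apply: le_trans (ler_wpM2r _ (ler_norm C)) _; first exact: sumr_ge0.
  rewrite ler_wpM2l//; apply: ler_sum => i _.
  have := xy.2 0 i; rewrite -ball_normE/= lt_min => /andP[_ /ltW].
  by rewrite distrC.
rewrite sumr_const card_ord -mulr_natr mulrCA -mulrA ler_piMr// ?(ltW e0)//.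
by rewrite mulrC ler_pdivrMr// mul1r /K lerDl.
Unshelve. all: by end_near. Qed.

(** Chain rule along a curve that is only derivable at 0, coordinate by coordinate; continuity of
    the partials at [x] takes the place of total differentiability of [f]. *)
Lemma derive_path f x (g : R -> 'rV[R]_N) (d : 'I_N -> R) :
  (\forall y \near x, forall i, derivable f y (e_ i)) ->
  (forall i, {for x, continuous (fun y => 'D_(e_ i) f y)}) ->
  g 0 = x -> (forall i, is_derive (0 : R) 1 (fun t => g t 0 i) (d i)) ->
  is_derive (0 : R) 1 (f \o g) (\sum_i 'D_(e_ i) f x * d i).
Proof.
move=> df cf g0 dg.
pose q i t := t^-1 * (g t 0 i - x 0 i).
have qd i : q i t @[t --> (0 : R)^'] --> d i.
  have [D1 D2] := dg i; rewrite -D2 /derive.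
  rewrite (_ : q i = (fun h : R => h^-1 *: (((fun t => g t 0 i) \o shift 0) (h *: (1 : R)) - g 0 0 i))).
    exact: D1.
  by apply/funext => h; rewrite /q /= addr0 g0 (_ : h *: (1 : R) = h)//; exact: mulr1.
have cg : g t @[t --> (0 : R)] --> x.
  apply: cvg_row => i; rewrite -g0.
  have [D1 _] := dg i.
  have c0 : {for (0 : R), continuous (fun t => g t 0 i)}.
    exact/differentiable_continuous/derivable1_diffP.
  exact: c0.
suff L : t^-1 * (f (g t) - f x) @[t --> (0 : R)^'] --> \sum_i 'D_(e_ i) f x * d i.
  have E : (fun h : R => h^-1 *: (((f \o g) \o shift 0) (h *: (1 : R)) - (f \o g) 0)) =
      (fun t => t^-1 * (f (g t) - f x)).
    by apply/funext => h; rewrite /= addr0 g0 (_ : h *: (1 : R) = h)//; exact: mulr1.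
  by split; rewrite ?/derivable ?/derive E; [apply/cvg_ex; eexists; exact: L|exact/cvg_lim].
(* The linearised quotient. Its distance to the quotient of [f] is small by [partials_estimate],
   because the [q i t] stay bounded near 0. *)
pose S t := \sum_i 'D_(e_ i) f x * q i t.
have LS : S t @[t --> (0 : R)^'] --> \sum_i 'D_(e_ i) f x * d i.
  apply: cvg_big => [|i _]; first exact: add_continuous.
  by apply: cvgM; [exact: cvg_cst|exact: qd].
rewrite -[X in _ --> X]add0r.
rewrite (_ : (fun t => _) = (fun t => (t^-1 * (f (g t) - f x) - S t) + S t)); last first.
  by apply/funext => t; rewrite subrK.
apply: cvgD => //.
pose K := \sum_i (`|d i| + 1) + 1.
have K0 : 0 < K by rewrite /K ltr_wpDl// sumr_ge0// => i _; rewrite addr_ge0.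
apply/cvgrPdist_le => /= e e0.
have eK : 0 < e / K by rewrite divr_gt0.
have FF : Filter (nbhs x) := nbhs_filter x.
have : \forall y \near x, forall i, derivable f y (e_ i) /\
     `|'D_(e_ i) f y - 'D_(e_ i) f x| <= e / K.
  have cf' : \forall y \near x, forall i, `|'D_(e_ i) f y - 'D_(e_ i) f x| <= e / K.
    have cfi i : nbhs x [set y | `|'D_(e_ i) f y - 'D_(e_ i) f x| <= e / K].
      have /cvgrPdist_le/(_ _ eK) := cf i; apply: filterS => y.
      by rewrite /= distrC.
    exact: (filter_forall FF cfi).
  by apply: filterS2 df cf' => y h1 h2 i; split.
move=> /nbhs_ballP[r /= r0 rB].
have est := partials_estimate rB.
have gB : \forall t \near (0 : R)^', ball x r (g t).
  by apply: cvg_within; apply: cg; exact: nbhsx_ballx.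
have qB : \forall t \near (0 : R)^', forall i, `|q i t| <= `|d i| + 1.
  apply: filter_forall => i; have /cvgrPdist_le/(_ 1 ltr01) := qd i.
  apply: filterS => t; rewrite distrC => h.
  by rewrite -[q i t](subrK (d i)) addrC (le_trans (ler_normD _ _))// lerD2l.
near=> t.
have t0 : t != 0 by near: t; exact: nbhs_dnbhs_neq.
have gt : ball x r (g t) by near: t.
have qt : forall i, `|q i t| <= `|d i| + 1 by near: t.
rewrite sub0r normrN.
rewrite (_ : _ - _ = t^-1 * (f (g t) - f x - \sum_i 'D_(e_ i) f x * (g t 0 i - x 0 i))); last first.
  rewrite [RHS]mulrBr; congr (_ - _); rewrite /S mulr_sumr; apply: eq_bigr => i _.
  by rewrite /q mulrCA.
rewrite normrM; apply: le_trans (ler_wpM2l _ (est _ gt)) _ => //.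
rewrite mulrCA mulr_sumr.
apply: (@le_trans _ _ (e / K * \sum_i (`|d i| + 1))).
  rewrite ler_wpM2l ?(ltW eK)//; apply: ler_sum => i _.
  by rewrite -normrM; exact: qt.
by rewrite -mulrA ler_piMr ?(ltW e0)// mulrC ler_pdivrMr// mul1r /K lerDl.
Unshelve. all: by end_near. Qed.

End Interior.

(** * Measurability of functions of row vectors and of their derivatives *)

Section Measurability.
Context {R : realType} {N : nat}.
Local Notation RN := (N.-tuple (measurableTypeR R)).

Definition grid (k : nat) (j : N.-tuple int) : 'rV[R]_N :=
  \row_i ((tnth j i)%:~R / k.+1%:R).

Definition round_down (k : nat) (t : RN) : N.-tuple int :=
  [tuple Num.floor (k.+1%:R * tnth t i) | i < N].

Lemma measurable_round_down k (j : N.-tuple int) :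
  measurable (round_down k @^-1` [set j]).
Proof.
rewrite (_ : _ @^-1` _ = \bigcap_(i in [set: 'I_N])
  ((fun t : RN => tnth t i) @^-1` (( *%R k.+1%:R) @^-1`
     `[(tnth j i)%:~R, (tnth j i + 1)%:~R[))).
  apply: fin_bigcap_measurable => // i _; rewrite -[X in measurable X]setTI.
  apply: (@measurable_tnth _ (measurableTypeR R) N i) => //.
  rewrite -[X in measurable X]setTI.
  exact: (@mulrl_measurable R setT k.+1%:R measurableT).
apply/seteqP; split => t /=.
  move=> <- i _ /=; rewrite tnth_mktuple in_itv/= floor_le_tmp.
  exact: floorD1_gt.
move=> h; apply: eq_from_tnth => i; rewrite tnth_mktuple; apply/floor_def.
by have := h i I; rewrite /= in_itv.
Qed.

Lemma grid_cvg (t : RN) : grid k (round_down k t) @[k --> \oo] --> row_of t.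
Proof.
apply: cvg_row => i; rewrite mxE.
under eq_fun do rewrite mxE tnth_mktuple.
apply/cvgrPdist_le => /= e e0.
near=> k.
have k0 : 0 < k.+1%:R :> R by [].
have ke : k.+1%:R^-1 <= e :> R.
  by apply/ltW; near: k; exact: (near_infty_natSinv_lt (PosNum e0)).
apply: le_trans ke.
rewrite -[X in `|X - _|](@mulKf _ k.+1%:R)// [_^-1 * _]mulrC -mulrBl normrM.
rewrite [X in _ * X]gtr0_norm ?invr_gt0// ler_piMl ?invr_ge0//.
rewrite ger0_norm ?subr_ge0 ?floor_le_tmp//.
rewrite lerBlDl; apply/ltW; rewrite -[1]/(1%:~R) -intrD.
exact: floorD1_gt.
Unshelve. all: by end_near. Qed.

(* The product sigma-algebra is not related to the topology of row vectors;
   [f] is the limit of its values at lattice points, which take countably many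
   values on measurable pieces. *)
Lemma measurable_continuous_row (D : set RN) (f : 'rV[R]_N -> R) :
  (forall t, D t -> {for row_of t, continuous f}) ->
  measurable_fun D (fun t => f (row_of t)).
Proof.
move=> cf mD; move: (mD).
apply: (@measurable_fun_cvg _ _ _ D (fun k t => f (grid k (round_down k t)))).
  move=> k; apply: measurable_funTS => _ B mB; rewrite setTI.
  pose G (l : nat) : set RN := if unpickle l is Some j then
    (if `[< B (f (grid k j)) >] then round_down k @^-1` [set j] else set0) else set0.
  rewrite (_ : _ @^-1` B = \bigcup_l G l).
    apply: bigcup_measurable => l _; rewrite /G.
    case: unpickle => [j|]; last exact: measurable0.
    by case: ifP => _; [exact: measurable_round_down|exact: measurable0].
  apply/seteqP; split => t /=.
    move=> h; exists (pickle (round_down k t)) => //.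
    by rewrite /G pickleK ifT//; exact/asboolP.
  move=> [l _]; rewrite /G; case: unpickle => // j.
  by case: ifP => // /asboolP h /= ->.
move=> t Dt; have fc : f y @[y --> row_of t] --> f (row_of t) := cf _ Dt.
move=> A /fc fA; exact: (@grid_cvg t _ fA).
Qed.

Lemma measurable_derive_row (U : set 'rV[R]_N) (f : 'rV[R]_N -> R) i :
  open U -> (forall x, U x -> {for x, continuous f}) ->
  (forall x, U x -> derivable f x (delta_mx 0 i)) ->
  measurable [set t : RN | U (row_of t)] ->
  measurable_fun [set t : RN | U (row_of t)]
    (fun t => 'D_(delta_mx 0 i) f (row_of t)).
Proof.
move=> oU cf df mU.
pose e : 'rV[R]_N := delta_mx 0 i.
(* A shifted point may leave [U], where nothing is known about [f]. Extension by 0 keeps each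
   difference quotient measurable, and for a fixed point of the open set [U] the shifts eventually
   stay inside. *)
pose fU x := if x \in U then f x else 0.
pose h (k : nat) : R := k.+1%:R^-1.
have h0 k : h k != 0 by rewrite invr_eq0.
apply: (@measurable_fun_cvg _ _ _ _
  (fun k t => (h k)^-1 * (fU (row_of t + h k *: e) - f (row_of t)))).
  move=> k; apply: measurable_funM; first exact: measurable_cst.
  apply: measurable_funB; last first.
    by apply: measurable_continuous_row => t; exact: cf.
  pose sh (t : RN) : RN := [tuple tnth t l + h k * e 0 l | l < N].
  have msh : measurable_fun setT sh.
    apply/measurable_fun_tnthP => l.
    rewrite (_ : _ \o _ = (fun t : RN => tnth t l + h k * e 0 l)); last first.
      by apply/funext => t /=; rewrite tnth_mktuple.
    apply: measurable_funD; last exact: measurable_cst.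
    exact: (@measurable_tnth _ (measurableTypeR R) N l).
  have shE t : row_of t + h k *: e = row_of (sh t).
    by apply/rowP => l; rewrite /row_of !mxE tnth_mktuple /e !mxE.
  rewrite (_ : (fun t : RN => fU (row_of t + h k *: e)) =
    (fun t => fU (row_of (sh t)))); last by apply/funext => t; rewrite shE.
  apply: measurable_funTS.
  apply: (@measurableT_comp _ _ _ _ _ _ (fun t : RN => fU (row_of t))) => //.
  rewrite (_ : (fun t => _) = ((fun t => f (row_of t)) \_ [set t : RN | U (row_of t)])); last first.
    apply/funext => t; rewrite patchE /fU.
    have -> : (t \in [set t : RN | U (row_of t)]) = (row_of t \in U).
      by apply/idP/idP; rewrite !inE.
    by [].
  apply/(measurable_restrictT _ mU).
  by apply: measurable_continuous_row => t; exact: cf.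
move=> t Ut; set x := row_of t.
have hc : h k @[k --> \oo] --> (0 : R)^'.
  move=> A nA.
  have hk : h k @[k --> \oo] --> (0 : R).
    by apply/cvgrPdist_lt => e0 e00; near=> k; rewrite sub0r normrN gtr0_norm ?invr_gt0//; near: k; exact: (near_infty_natSinv_lt (PosNum e00)).
  have H : \forall k \near \oo, h k != 0 -> A (h k) := hk _ nA.
  by apply: filterS H => k; apply.
have D : (fun k => (h k)^-1 * (f (x + h k *: e) - f x)) @ \oo --> 'D_e f x.
  have D1 := df x Ut; have := cvg_comp _ _ hc D1; rewrite /derive.
  rewrite (_ : _ \o h = (fun k => (h k)^-1 * (f (x + h k *: e) - f x)))//.
  by apply/funext => k; rewrite /= [_ + x]addrC.
apply: cvg_trans D; apply: near_eq_cvg.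
have Uk : \forall k \near \oo, U (x + h k *: e).
  have xU : nbhs x U by exact: open_nbhs_nbhs.
  have nA : nbhs (0 : R) [set l | U (x + l *: e)] := @line_cvg _ _ x e _ xU.
  have nB : (0 : R)^' [set l | U (x + l *: e)] 
    by apply: filterS nA => l Hl _.
  exact: (hc _ nB).
by near=> k; rewrite /fU ifT// inE; near: k.
Unshelve. all: by end_near. Qed.

End Measurability.

(** * Calculus in the interior of the exterior region *)

Section Derivatives.
Context {R : realType} {n : nat}.
Implicit Types (x : 'rV[R]_n.+1).
Local Notation e_ i := (delta_mx 0 i : 'rV[R]_n.+1).

(** An open set on which [partial] is the ordinary derivative; it contains every upper hemisphere of
    radius greater than 1. *)
Definition interior_end : set 'rV[R]_n.+1 := [set x | 0 < last_coord x /\ 1 < enorm x].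

Lemma coord_cvg N (x : 'rV[R]_N) i : y 0 i @[y --> x] --> x 0 i.
Proof. exact: coord_continuous. Qed.

Lemma enorm_continuous N (x : 'rV[R]_N) : {for x, continuous (@enorm R N)}.
Proof.
have S : \sum_i y 0 i ^+ 2 @[y --> x] --> \sum_i x 0 i ^+ 2.
  apply: (@cvg_big _ _ _ _ _ add_continuous) => i _.
  by under eq_fun do rewrite expr2; rewrite expr2; apply: cvgM; exact: coord_cvg.
have Q := @sqrt_continuous R (\sum_i x 0 i ^+ 2).
by move=> A /Q QA; exact: (S _ QA).
Qed.

Lemma open_interior_end : open interior_end.
Proof.
rewrite openE => x [z0 r1]; apply: filterI.
  have c : last_coord y @[y --> x] --> last_coord x by exact: coord_cvg.
  exact: (c _ (lt_nbhsr z0)).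
exact: ((@enorm_continuous _ x) _ (lt_nbhsr r1)).
Qed.

Lemma interior_end_exterior x : interior_end x -> exterior R n x.
Proof. by move=> [/ltW]. Qed.

Lemma interior_end_nbhs x : interior_end x -> nbhs x (exterior R n).
Proof.
move=> xU; apply: filterS (open_nbhs_nbhs (conj open_interior_end xU)).
exact: interior_end_exterior.
Qed.

Lemma is_derive_near (f g : 'rV[R]_n.+1 -> R) x v d :
  (\forall y \near x, f y = g y) -> is_derive x v g d -> is_derive x v f d.
Proof.
move=> fg [dg Dg].
have E : \forall h \near (0 : R)^', h^-1 *: ((g \o shift x) (h *: v) - g x) =
     h^-1 *: ((f \o shift x) (h *: v) - f x).
  have L : nbhs (0 : R) [set h | f (x + h *: v) = g (x + h *: v)] := @line_cvg _ _ x v _ fg.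
  have fx : f x = g x := nbhs_singleton fg.
  have L' : (0 : R)^' [set h | f (x + h *: v) = g (x + h *: v)].
    by apply: filterS L => h + _.
  by apply: filterS L' => h /= hE; rewrite [h *: v + x]addrC hE fx.
have C : h^-1 *: ((f \o shift x) (h *: v) - f x) @[h --> (0 : R)^'] --> d.
  apply: cvg_trans (near_eq_cvg E) _; rewrite -Dg; exact: dg.
by split; [apply/cvg_ex; exists d | exact/cvg_lim].
Qed.

Lemma is_derive_lineV (f : 'rV[R]_n.+1 -> R) x v d :
  is_derive (0 : R) 1 (fun t => f (x + t *: v)) d -> is_derive x v f d.
Proof.
have E : (fun h : R => h^-1 *: (((fun t => f (x + t *: v)) \o shift 0) (h *: (1 : R)) -
      f (x + 0 *: v))) = (fun h => h^-1 *: ((f \o shift x) (h *: v) - f x)).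
  apply/funext => h /=; rewrite (_ : h *: (1 : R) = h); last exact: mulr1.
  by rewrite addr0 scale0r addr0 [x + _]addrC.
by move=> [df Df]; split; [rewrite /derivable -E|rewrite /derive -E].
Qed.

Lemma is_derive_coord x i k :
  is_derive x (e_ i) (fun y : 'rV[R]_n.+1 => y 0 k) (k == i)%:R.
Proof.
apply: is_derive_lineV.
rewrite (_ : (fun t : R => (x + t *: e_ i) 0 k) =
  (fun t => x 0 k + (k == i)%:R *: t)).
  have D := is_deriveD (is_derive_cst (x 0 k) (0 : R) 1)
    (is_deriveZ ((k == i)%:R : R) (is_derive_id (0 : R) 1)).
  by apply: (is_derive_eq D); rewrite add0r; exact: mulr1.
by apply/funext => t; rewrite !mxE eqxx/= [RHS]addrC addrC mulrC.
Qed.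

(** As a power [p / 2] of the sum of squares, the function needs no derivative of the square root:
    along a coordinate line that sum is a quadratic polynomial in the parameter. *)
Lemma is_derive_enorm_pow x i (p : R) : 0 < enorm x ->
  is_derive x (e_ i) (fun y => enorm y `^ p) (p * enorm x `^ (p - 2) * x 0 i).
Proof.
move=> x0; apply: is_derive_lineV.
have Epow (y : 'rV[R]_n.+1) q : enorm y `^ q = (\sum_k y 0 k ^+ 2) `^ (q / 2).
  by rewrite /enorm -powR12_sqrt ?sumr_ge0 // => [|k _]; rewrite ?sqr_ge0 // -powRrM mulrC.
set S := \sum_k x 0 k ^+ 2.
have S0 : 0 < S by rewrite -[S]enorm_sq exprn_gt0.
have ES t : \sum_k (x + t *: e_ i) 0 k ^+ 2 = S + t * (2 * x 0 i) + t ^+ 2.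
  rewrite /S (bigD1 i)//= [in RHS](bigD1 i)//=.
  rewrite !mxE !eqxx/= mulr1 (eq_bigr (fun k => x 0 k ^+ 2)); first by ring.
  by move=> k ki; rewrite !mxE (negbTE ki) andbF mulr0 addr0.
rewrite (_ : (fun t : R => _) = (fun u => u `^ (p / 2)) \o (fun t => S + t * (2 * x 0 i) + t ^+ 2)); last first.
  by apply/funext => t; rewrite Epow ES.
have D1 : is_derive (0 : R) 1 (fun t : R => S + t * (2 * x 0 i) + t ^+ 2) (2 * x 0 i).
  have D2 : is_derive (0 : R) 1 (fun t : R => (2 * x 0 i) *: t) ((2 * x 0 i) *: 1).
    exact: is_deriveZ.
  have D3 : is_derive (0 : R) 1 (fun t : R => t ^+ 2) ((2%:R * (0 : R) ^+ 1) *: 1).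
    exact: (@is_deriveX _ _ id 2 0 1 1 _).
  have := is_deriveD (is_deriveD (is_derive_cst S (0 : R) 1) D2) D3.
  rewrite (_ : _ + _ + _ = (fun t : R => S + t * (2 * x 0 i) + t ^+ 2)); last first.
    by apply/funext => t; rewrite /= /GRing.scale/= [t * _]mulrC.
  move=> D4; apply: (is_derive_eq D4).
  by rewrite /GRing.scale/= add0r expr1 mulr0 mul0r addr0 mulr1.
have := @is_derive1_comp _ (fun u => u `^ (p / 2)) _ 0 _ _ _ D1.
rewrite mul0r addr0 expr0n addr0 => /(_ _ (is_derive1_powR _ S0)) D5.
apply: (is_derive_eq D5).
by rewrite Epow -/S (_ : (p - 2) / 2 = p / 2 - 1); [field|field].
Qed.

Lemma bigO'_interior (alpha : R) (f : 'rV[R]_n.+1 -> R) : bigO' alpha f ->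
  exists2 C : R, 0 < C & forall x, interior_end x ->
    `|f x| <= C * enorm x `^ alpha /\ forall i, derivable f x (e_ i) /\
      `|'D_(e_ i) f x| <= C * enorm x `^ (alpha - 1).
Proof.
move=> [C C0 H]; exists C => // x xU.
have [fx dfx] := H x (interior_end_exterior xU); split=> // i.
have xE := interior_end_nbhs xU.
have [h1 h2] := dfx i; split; first exact/(has_partial_interior f i xE).
by rewrite -(partial_interior f i xE).
Qed.

Lemma enorm_pow_le1 x (q : R) : 1 < enorm x -> q <= 0 -> enorm x `^ q <= 1.
Proof. by move=> x1 q0; rewrite -(powRr0 (enorm x)) ler_powR// ltW. Qed.

Lemma ratio_le1 x i : `|x 0 i / enorm x| <= 1.
Proof.
rewrite normrM normfV (ger0_norm (enorm_ge0 x)).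
have [->|x0] := eqVneq (enorm x) 0; first by rewrite invr0 mulr0.
by rewrite ler_pdivrMr ?mul1r ?coord_le_enorm// lt_neqAle eq_sym x0 enorm_ge0.
Qed.

End Derivatives.

Arguments interior_end {R} n.


(** * Expansion of the flux integrand *)

Lemma uniform_constant (R : realType) (I : finType) (P : I -> R -> Prop) :
  (forall i c c', c <= c' -> P i c -> P i c') ->
  (forall i, exists2 c, 0 < c & P i c) -> exists2 c, 0 < c & forall i, P i c.
Proof.
move=> mono H.
have /choice[f Hf] : forall i, exists c, 0 < c /\ P i c by move=> i; have [c ? ?] := H i; exists c.
(* The summand 1 keeps the constant positive when [I] is empty. *)
exists (1 + \sum_i f i).
  by rewrite ltr_wpDr ?sumr_ge0// => i _; exact/ltW/(Hf i).1.
move=> i; apply: mono (Hf i).2.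
rewrite (bigD1 i)//= addrCA lerDl addr_ge0 ?sumr_ge0// => j _.
exact/ltW/(Hf j).1.
Qed.

Section Expansion.
Context {R : realType} {n : nat} (X : smms R n) (phi : chart R n (smms_space X)) (a s : R).
Context (asymp : asymptotically_Schwarzschild phi a s).

Local Notation e_ i := (delta_mx 0 i : 'rV[R]_n.+1).
Local Notation U := (interior_end n).
Local Notation m := (weight X).
Local Notation p := (1 - n%:R - m).
Local Notation al := (s - n%:R - m).
Local Notation r x := (enorm x).
Local Notation z x := (last_coord x).

Lemma metric_expansion : exists2 C : R, 0 < C & forall i j x, U x ->
  [/\ metric_pert phi i j x = (i == j)%:R * (a * r x `^ p) + metric_error phi a i j x,
      `|metric_error phi a i j x| <= C * r x `^ al &
      forall k, is_derive x (e_ k) (metric_pert phi i j)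
          ((i == j)%:R * (a * (p * r x `^ (p - 2) * x 0 k))
           + 'D_(e_ k) (metric_error phi a i j) x) /\
        `|'D_(e_ k) (metric_error phi a i j) x| <= C * r x `^ (al - 1)].
Proof.
have [_ _ O _] := asymp.
have [C C0 HC] := @uniform_constant R ('I_n.+1 * 'I_n.+1)%type
  (fun ij c => forall x, U x -> `|metric_error phi a ij.1 ij.2 x| <= c * r x `^ al /\
    forall k, derivable (metric_error phi a ij.1 ij.2) x (e_ k) /\
      `|'D_(e_ k) (metric_error phi a ij.1 ij.2) x| <= c * r x `^ (al - 1))
  (fun ij c c' cc' H x xU => conj (le_trans (H x xU).1 (ler_wpM2r (powR_ge0 _ _) cc'))
     (fun k => conj ((H x xU).2 k).1 (le_trans ((H x xU).2 k).2 (ler_wpM2r (powR_ge0 _ _) cc'))))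
  (fun ij => bigO'_interior (O ij.1 ij.2)).
exists C => // i j x xU; have [HE HD] := HC (i, j) x xU.
have x0 : 0 < r x by apply: lt_trans xU.2.
have E y : metric_pert phi i j y = (i == j)%:R * (a * r y `^ p) + metric_error phi a i j y.
  by rewrite /metric_pert /metric_error; ring.
split=> // k; have [dE bE] := HD k; split=> //.
have D1 := is_deriveZ ((i == j)%:R * a : R) (is_derive_enorm_pow k p x0).
have D2 := is_deriveD D1 (DeriveDef dE erefl).
apply: (@is_derive_near _ _ _ (((i == j)%:R * a : R) \*: (fun y => r y `^ p) +
    metric_error phi a i j)).
  by apply: filterS (interior_end_nbhs xU) => y _; rewrite E mulrA.
apply: (is_derive_eq D2); rewrite mulrA; congr (_ + _).
Qed.

Lemma density_expansion : exists h : 'rV[R]_n.+1 -> R, exists2 C : R, 0 < C &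
  forall x, U x ->
  [/\ push_density phi x = z x * (1 + a / 2 * r x `^ p + h x),
      `|h x| <= C * r x `^ al &
      forall k,
       [/\ is_derive x (e_ k) (density_pert phi)
            (a / 2 * (p * r x `^ (p - 2) * x 0 k * z x + r x `^ p * (ord_max == k)%:R)
             + (ord_max == k)%:R * h x + z x * 'D_(e_ k) h x),
        derivable h x (e_ k) &
        `|'D_(e_ k) h x| <= C * r x `^ (al - 1)]].
Proof.
have [_ _ _ [h Oh Eh]] := asymp.
have [C C0 HC] := bigO'_interior Oh.
exists h, C => // x xU; have [Hh HD] := HC x xU.
have x0 : 0 < r x by apply: lt_trans xU.2.
split=> //; first by rewrite Eh; [ring|exact: interior_end_exterior].
move=> k; have [dh bh] := HD k; split=> //.
apply: (@is_derive_near _ _ _ (fun y => a / 2 * (r y `^ p * z y) + z y * h y)).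
  apply: filterS (interior_end_nbhs xU) => y yU.
  by rewrite /density_pert Eh; [ring|exact: yU].
have Dz := is_derive_coord x k ord_max.
have D1 := is_deriveZ (a / 2 : R) (is_deriveM (is_derive_enorm_pow k p x0) Dz).
have D2 := is_deriveD D1 (is_deriveM Dz (DeriveDef dh erefl)).
apply: (is_derive_eq D2); rewrite /GRing.scale/= -/(last_coord x); ring.
Qed.

Context (weight_cases : 0 <= m < 1 \/ (-1 < m < 0 /\ refined_metric_error phi a s)).

(** Equivalently [p < 0]: the perturbations decay, and their powers are at most 1 where [r > 1]. *)
Lemma weight_gt1 : 1 < n%:R + m.
Proof. by have := @weight_gt _ _ X; lra. Qed.

Lemma sum_ratio_bound (x : 'rV[R]_n.+1) (f : 'I_n.+1 -> R) (B : R) :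
  (forall i, `|f i| <= B) -> `|\sum_i f i * (x 0 i / r x)| <= n.+1%:R * B.
Proof.
move=> fB; apply: le_trans (ler_norm_sum _ _ _) _.
rewrite mulr_natl -[in leRHS](card_ord n.+1) -sumr_const; apply: ler_sum => i _.
by rewrite normrM; apply: le_trans (fB i); rewrite ler_piMr// ratio_le1.
Qed.

(** To leading order the metric derivatives give [- n a p r^(p-2) x_i] and the density term
    [- m a p r^(p-2) x_i], while the two terms [m a r^p / x_(n+1)] in the normal direction cancel.
    Contraction with [x_i / r] yields [- (n + m) a p r^(p-1)], where [- p = m + n - 1]. The
    undifferentiated density error loses its factor [1 / x_(n+1)] in the contraction; the metric
    error keeps it and is therefore displayed separately. *)
Lemma mass_form_contraction : exists2 h : 'rV[R]_n.+1 -> R,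
  (exists2 C : R, 0 < C & forall x, U x ->
    `|h x| <= C * r x `^ (al - 1)) & forall x, U x ->
  \sum_i mass_form phi i x * (x 0 i / r x) =
    (m + n%:R) * (m + n%:R - 1) * a * r x `^ (- n%:R - m) + h x +
    m * (z x)^-1 * \sum_i metric_error phi a ord_max i x * (x 0 i / r x).
Proof.
have [C C0 HE] := metric_expansion.
have [h [C' C'0 Hh]] := density_expansion.
pose F i x := \sum_(j < n.+1) ('D_(e_ j) (metric_error phi a i j) x
                                 - 'D_(e_ i) (metric_error phi a j j) x).
exists (fun x => \sum_i F i x * (x 0 i / r x) - 2 * m * (h x / r x)
  - 2 * m * \sum_i 'D_(e_ i) h x * (x 0 i / r x)).
  pose K1 := n.+1%:R * (n.+1%:R * (2 * C)); pose K2 := `|2 * m| * C'.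
  pose K3 := `|2 * m| * (n.+1%:R * C').
  have K10 : 0 < K1 by rewrite /K1 !mulr_gt0.
  have K20 : 0 <= K2 by rewrite /K2 mulr_ge0// ltW.
  have K30 : 0 <= K3 by rewrite /K3 !mulr_ge0// ltW.
  exists (K1 + K2 + K3); first by lra.
  move=> x xU; have [_ hx dh] := Hh x xU.
  have x0 : 0 < r x by apply: lt_trans xU.2.
  have rE : r x `^ (al - 1) = r x `^ al / r x.
    by rewrite powRD ?(gt_eqF x0) ?implybT// powR_inv1// ltW.
  have B1 : `|\sum_i F i x * (x 0 i / r x)| <= K1 * r x `^ (al - 1).
    rewrite /K1 -!mulrA; apply: sum_ratio_bound => i.
    rewrite mulr_natl.
    have -> : 2 * (C * r x `^ (al - 1)) *+ n.+1 = \sum_(j < n.+1) 2 * (C * r x `^ (al - 1)).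
      by rewrite sumr_const card_ord.
    apply: le_trans (ler_norm_sum _ _ _) _; apply: ler_sum => j _.
    apply: le_trans (ler_normB _ _) _.
    have [_ _ /(_ j)[_ b1]] := HE i j x xU.
    have [_ _ /(_ i)[_ b2]] := HE j j x xU.
    by apply: le_trans (lerD b1 b2) _; rewrite le_eqVlt; apply/orP; left; apply/eqP; ring.
  have B2 : `|2 * m * (h x / r x)| <= K2 * r x `^ (al - 1).
    rewrite normrM /K2 -[leRHS]mulrA ler_wpM2l// rE normrM [leRHS]mulrA.
    by rewrite [`|_^-1|]gtr0_norm ?invr_gt0// ler_wpM2r// invr_ge0 ltW.
  have B3 : `|2 * m * \sum_i 'D_(e_ i) h x * (x 0 i / r x)| <= K3 * r x `^ (al - 1).
    rewrite normrM /K3 -[leRHS]mulrA ler_wpM2l// -mulrA; apply: sum_ratio_bound => i.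
    by have [] := dh i.
  rewrite [leRHS]mulrDl; apply: le_trans (ler_normB _ _) (lerD _ B3).
  by rewrite [leRHS]mulrDl; exact: le_trans (ler_normB _ _) (lerD B1 B2).
move=> x xU; have [_ _ dh] := Hh x xU.
have x0 : 0 < r x by apply: lt_trans xU.2.
have z0 : 0 < z x := xU.1.
have xE := interior_end_nbhs xU.
have MF i : mass_form phi i x = - (n%:R + m) * a * p * r x `^ (p - 2) * x 0 i + F i x
    + m * (z x)^-1 * metric_error phi a ord_max i x
    - 2 * m * (z x)^-1 * ((ord_max == i)%:R * h x) - 2 * m * 'D_(e_ i) h x.
  rewrite /mass_form.
  (* The factor [1 - (n + 1)] counts one diagonal divergence term against [n + 1] trace terms. *)
  have -> : \sum_(j < n.+1) (partial (exterior R n) (metric_pert phi i j) j x -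
     partial (exterior R n) (metric_pert phi j j) i x) =
     a * p * r x `^ (p - 2) * x 0 i * (1 - n.+1%:R) + F i x.
    transitivity (\sum_(j < n.+1) (((i == j)%:R * (a * p * r x `^ (p - 2) * x 0 i) -
        a * p * r x `^ (p - 2) * x 0 i) +
      ('D_(e_ j) (metric_error phi a i j) x - 'D_(e_ i) (metric_error phi a j j) x))).
      apply: eq_bigr => j _; rewrite !partial_interior//.
      have [_ _ /(_ j)[[_ ->] _]] := HE i j x xU.
      have [_ _ /(_ i)[[_ ->] _]] := HE j j x xU.
      by rewrite eqxx; case: eqVneq => [->|_] /=; rewrite ?mulr1n ?mulr0n ?mul1r ?mul0r; ring.
    rewrite big_split/=; congr (_ + _); rewrite sumrB.
    rewrite (bigD1 i)//= eqxx mul1r big1 ?addr0; last first.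
      by move=> j ji; rewrite eq_sym (negbTE ji) mul0r.
    by rewrite sumr_const card_ord -mulr_natr; ring.
  rewrite partial_interior//; have [[_ ->] _ _] := dh i.
  have [-> _ _] := HE ord_max i x xU.
  by rewrite -natr1; field; rewrite gt_eqF.
under eq_bigr do rewrite MF.
transitivity (\sum_i ((- (n%:R + m) * a * p * r x `^ (p - 2) / r x * x 0 i ^+ 2)
   + F i x * (x 0 i / r x)
   + m * (z x)^-1 * (metric_error phi a ord_max i x * (x 0 i / r x))
   - 2 * m * (z x)^-1 * h x * ((ord_max == i)%:R * (x 0 i / r x))
   - 2 * m * ('D_(e_ i) h x * (x 0 i / r x)))).
  by apply: eq_bigr => i _; ring.
rewrite !(sumrB, big_split)/= -!mulr_sumr -enorm_sq.
rewrite (_ : \sum_i (ord_max == i)%:R * (x 0 i / r x) = z x / r x); last first.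
  rewrite (bigD1 ord_max)//= eqxx mul1r big1 ?addr0//.
  by move=> j ji; rewrite eq_sym (negbTE ji) mul0r.
have -> : r x `^ (- n%:R - m) = r x `^ (p - 2) / r x * r x ^+ 2.
  rewrite -powR_inv1 ?(ltW x0)// -powR_mulrn ?(ltW x0)//.
  by rewrite -!powRD ?(gt_eqF x0) ?implybT//; congr (_ `^ _); ring.
by field; rewrite !gt_eqF.
Qed.

(* [nu = m - 1] if [m > 0], and [nu = m] otherwise, where the refined form of
   the metric error absorbs the factor [1 / x_(n+1)]. *)
Lemma bulk_estimate : exists nu : R, -1 < nu /\ exists2 K : R, 0 < K & forall x, U x ->
  `|bulk_integrand phi x - (m + n%:R) * (m + n%:R - 1) * a * r x `^ (- n%:R - m) * z x `^ m|
    <= K * r x `^ (s - n%:R - 1 - nu) * z x `^ nu.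
Proof.
have n1 := weight_gt1.
have [h [C C0 hC] HM] := mass_form_contraction.
have [C1 C10 HE] := metric_expansion.
pose T x := \sum_i metric_error phi a ord_max i x * (x 0 i / r x).
suff [nu nu1 [K K0 HK]] : exists2 nu : R, -1 < nu & exists2 K : R, 0 < K & forall x, U x ->
    `|h x| * z x `^ m <= K * r x `^ (s - n%:R - 1 - nu) * z x `^ nu /\
    `|m * (z x)^-1 * T x| * z x `^ m <= K * r x `^ (s - n%:R - 1 - nu) * z x `^ nu.
  exists nu; split => //; exists (2 * K); first lra.
  move=> x xU; have [h1 h2] := HK x xU.
  rewrite /bulk_integrand HM// -mulrBl normrM [`|_ `^ m|]ger0_norm ?powR_ge0//.
  rewrite -/(T x) (_ : _ - _ = h x + m * (z x)^-1 * T x); last by ring.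
  apply: le_trans (ler_wpM2r (powR_ge0 _ _) (ler_normD _ _)) _.
  by rewrite mulrDl; lra.
have TB x : U x -> `|T x| <= n.+1%:R * (C1 * r x `^ al).
  by move=> xU; apply: sum_ratio_bound => i; have [] := HE ord_max i x xU.
have hB x : U x -> `|h x| * z x `^ m <= C * r x `^ (al - 1) * z x `^ m.
  by move=> xU; rewrite ler_wpM2r ?powR_ge0// hC.
have zr x : U x -> z x <= r x.
  by move=> _; apply: le_trans (ler_norm _) (coord_le_enorm _ _).
(* For [m > 0] the singular term dictates [nu = m - 1], and the bound on [h] is brought to the same
   form by trading a factor [x_(n+1)] for [r]. *)
have [m0|m0] := ltP 0 m.
  exists (m - 1); first lra.
  pose K := C + m * (n.+1%:R * C1).
  have K1 : 0 < m * (n.+1%:R * C1) by rewrite !mulr_gt0.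
  exists K; first by rewrite /K; lra.
  move=> x xU; have [z0 r1] := xU.
  have r0 : 0 < r x by apply: lt_trans r1.
  have -> : s - n%:R - 1 - (m - 1) = al by ring.
  have zE : z x `^ m = z x `^ (m - 1) * z x.
    by rewrite -[X in _ * X]powRr1 ?(ltW z0)// -powRD ?(gt_eqF z0) ?implybT// subrK.
  have rE : r x `^ al = r x `^ (al - 1) * r x.
    by rewrite -[X in _ * X]powRr1 ?(ltW r0)// -powRD ?(gt_eqF r0) ?implybT// subrK.
  have g1 : 0 <= z x `^ (m - 1) by exact: powR_ge0.
  have g2 : 0 <= r x `^ (al - 1) by exact: powR_ge0.
  have g3 : 0 <= r x `^ al by exact: powR_ge0.
  split.
    apply: le_trans (hB _ xU) _; rewrite zE rE.
    rewrite (_ : _ * (_ * z x) = C * z x * (r x `^ (al - 1) * z x `^ (m - 1))); last by ring.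
    rewrite (_ : K * _ * _ = K * r x * (r x `^ (al - 1) * z x `^ (m - 1))); last by ring.
    rewrite ler_wpM2r ?mulr_ge0// ler_pM ?(ltW C0) ?(ltW z0) ?zr// /K; lra.
  rewrite !normrM (gtr0_norm m0) normfV (gtr0_norm z0) zE.
  rewrite (_ : m * (z x)^-1 * `|T x| * (z x `^ (m - 1) * z x) = m * `|T x| * z x `^ (m - 1)); last first.
    by field; rewrite gt_eqF.
  rewrite ler_wpM2r//; apply: le_trans (ler_wpM2l (ltW m0) (TB _ xU)) _.
  by rewrite !mulrA ler_wpM2r// /K -!mulrA; lra.
have mm : -1 < m by case: weight_cases => [|[]] /andP[]; lra.
exists m => //.
have -> : s - n%:R - 1 - m = al - 1 by ring.
(* At [m = 0] the coefficient [m] removes the singular term, so the plain metric error suffices. *)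
have [m1|m1] := eqVneq m 0.
  exists C => // x xU; split; first exact: hB.
  by rewrite {1}m1 !mul0r normr0 mul0r !mulr_ge0 ?powR_ge0// ltW.
have [_ [E0 [E1 [OE0 OE1 HEE]]]] : -1 < m < 0 /\ refined_metric_error phi a s.
  by case: weight_cases => // /andP[m2 _]; move: m1; rewrite eq_le m0 m2.
have [C2 C20 HE0] := bigO'_interior OE0.
have [C3 C30 HE1] := @uniform_constant R 'I_n.+1
  (fun i c => forall x, U x -> `|E1 ord_max i x| <= c * r x `^ (al - 1))
  (fun i c c' cc' H x xU => le_trans (H x xU) (ler_wpM2r (powR_ge0 _ _) cc'))
  (fun i => let: ex_intro2 c c0 H := bigO'_interior (OE1 ord_max i) in
     ex_intro2 _ _ c c0 (fun x xU => (H x xU).1)).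
pose K := C + `|m| * (C2 + n.+1%:R * C3).
have K1 : 0 <= `|m| * (C2 + n.+1%:R * C3).
  by rewrite mulr_ge0// addr_ge0 ?mulr_ge0// ltW.
exists K; first by rewrite /K; lra.
move=> x xU; have [z0 r1] := xU.
have r0 : 0 < r x by apply: lt_trans r1.
split; first by apply: le_trans (hB _ xU) _; rewrite !ler_wpM2r ?powR_ge0// /K; lra.
(* Both parts of the refined error absorb [1 / x_(n+1)]: the diagonal one because its contraction
   contains [x_(n+1) / r], the other through its explicit factor [x_(n+1)]. *)
have TE : (z x)^-1 * T x = E0 x / r x + \sum_i E1 ord_max i x * (x 0 i / r x).
  rewrite /T (eq_bigr (fun i => E0 x * ((ord_max == i)%:R * (x 0 i / r x)) +
      z x * (E1 ord_max i x * (x 0 i / r x)))); last first.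
    by move=> i _; rewrite HEE ?mulrDl -?mulrA//; exact: interior_end_exterior.
  rewrite big_split/= -!mulr_sumr (bigD1 ord_max)//= eqxx mul1r big1 ?addr0; last first.
    by move=> j ji; rewrite eq_sym (negbTE ji) mul0r.
  by rewrite -/(z x); field; rewrite !gt_eqF.
rewrite ler_wpM2r ?powR_ge0// -mulrA TE normrM.
apply: (@le_trans _ _ (`|m| * ((C2 + n.+1%:R * C3) * r x `^ (al - 1)))); last first.
  by rewrite mulrA ler_wpM2r ?powR_ge0// /K; lra.
rewrite ler_wpM2l//; apply: le_trans (ler_normD _ _) _; rewrite mulrDl; apply: lerD.
  rewrite normrM normfV (gtr0_norm r0) ler_pdivrMr// -mulrA.
  apply: le_trans (HE0 x xU).1 _; rewrite ler_wpM2l ?(ltW C20)//.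
  by rewrite -[X in _ * X]powRr1 ?(ltW r0)// -powRD ?(gt_eqF r0) ?implybT// subrK.
rewrite -mulrA; apply: sum_ratio_bound => i; exact: HE1.
Qed.

(** Serves measurability. The partials are bounded on the whole of [U] because [r > 1] and the
    exponents [p - 1] and [s - n - m - 1] are negative. *)
Lemma metric_pert_continuous i j x : U x -> {for x, continuous (metric_pert phi i j)}.
Proof.
have n1 := weight_gt1; have [_ /andP[s0 s1] _ _] := asymp.
have [C C0 HE] := metric_expansion.
move=> xU; apply: (@bounded_partials_continuous _ _ _ _ (`|a| * `|p| + C) U).
  exact: (open_nbhs_nbhs (conj (@open_interior_end R n) xU)).
move=> y yU k; have [_ _ /(_ k)[[d ->] b]] := HE i j y yU; split => //.
have [z0 r1] := yU; have r0 : 0 < r y by apply: lt_trans r1.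
apply: le_trans (ler_normD _ _) _; apply: lerD.
  have -> : (i == j)%:R * (a * (p * r y `^ (p - 2) * y 0 k)) =
    ((i == j)%:R * (y 0 k / r y)) * (a * p * r y `^ (p - 1)).
    have -> : r y `^ (p - 1) = r y `^ (p - 2) * r y.
      rewrite -[X in _ * X]powRr1 ?(ltW r0)// -powRD ?(gt_eqF r0) ?implybT//.
      by congr (_ `^ _); ring.
    by field; rewrite gt_eqF.
  rewrite !normrM [`|_ `^ _|]ger0_norm ?powR_ge0//.
  rewrite -[leRHS]mul1r ler_pM ?mulr_ge0 ?powR_ge0//.
    rewrite -[leRHS]mulr1 -normrM ler_pM// ?ratio_le1//.
    by case: (i == j); rewrite ?normr1 ?normr0.
  by rewrite ler_piMr ?mulr_ge0// enorm_pow_le1//; lra.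
apply: le_trans b _; rewrite ler_piMr ?(ltW C0)// enorm_pow_le1//; lra.
Qed.

Lemma density_pert_continuous x : U x -> {for x, continuous (density_pert phi)}.
Proof.
have n1 := weight_gt1; have [_ /andP[s0 s1] _ _] := asymp.
have [h [C C0 HE]] := density_expansion.
move=> xU; apply: (@bounded_partials_continuous _ _ _ _ (`|a / 2| * (`|p| + 1) + C + C) U).
  exact: (open_nbhs_nbhs (conj (@open_interior_end R n) xU)).
move=> y yU k; have [_ b1 /(_ k)[[d ->] _ b2]] := HE y yU; split => //.
have [z0 r1] := yU; have r0 : 0 < r y by apply: lt_trans r1.
have zr : `|z y| <= r y by exact: coord_le_enorm.
have rp1 : r y `^ p <= 1 by rewrite enorm_pow_le1//; lra.
have ral1 : r y `^ al <= 1 by rewrite enorm_pow_le1//; lra.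
have d1 : `|(ord_max == k)%:R : R| <= 1 by case: (_ == _); rewrite ?normr1 ?normr0.
apply: le_trans (ler_normD _ _) _; apply: lerD; last first.
  rewrite normrM; apply: (@le_trans _ _ (r y * (C * r y `^ (al - 1)))).
    exact: ler_pM.
  have -> : r y * (C * r y `^ (al - 1)) = C * r y `^ al.
    rewrite mulrCA; congr (_ * _).
    by rewrite -[X in X * _]powRr1 ?(ltW r0)// -powRD ?(gt_eqF r0) ?implybT// addrC subrK.
  by rewrite ler_piMr ?(ltW C0).
apply: le_trans (ler_normD _ _) _; apply: lerD; last first.
  rewrite normrM -[leRHS]mul1r; apply: ler_pM => //.
  by apply: le_trans b1 _; rewrite ler_piMr ?(ltW C0).
rewrite normrM ler_wpM2l//; apply: le_trans (ler_normD _ _) _; apply: lerD; last first.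
  rewrite normrM -[leRHS]mul1r; apply: ler_pM => //.
  by rewrite ger0_norm ?powR_ge0.
have -> : p * r y `^ (p - 2) * y 0 k * z y = p * (r y `^ p * ((y 0 k / r y) * (z y / r y))).
  have -> : r y `^ p = r y `^ (p - 2) * r y ^+ 2.
    rewrite -powR_mulrn ?(ltW r0)// -powRD ?(gt_eqF r0) ?implybT//.
    by congr (_ `^ _); ring.
  by field; rewrite gt_eqF.
rewrite normrM ler_piMr// normrM mulr_ile1// ?normr_ge0//.
  by rewrite ger0_norm ?powR_ge0.
by rewrite normrM mulr_ile1// ratio_le1.
Qed.

End Expansion.


(** * The mass *)

Lemma measurable_funV_gt0 d (T : measurableType d) (R : realType) (D : set T) (f : T -> R) :
  measurable_fun D f -> (forall t, D t -> 0 < f t) -> measurable_fun D (fun t => (f t)^-1).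
Proof.
move=> mf f0; apply: (@eq_measurable_fun _ _ _ _ _ (fun t => f t `^ (-1))).
  by move=> t /set_mem Dt; apply: powR_inv1; apply/ltW/f0.
exact: (measurableT_comp (@measurable_powR R (-1)) mf).
Qed.

Lemma powR_small (R : realType) (q e : R) : q < 0 -> 0 < e ->
  exists2 B : R, 0 < B & forall rho, B <= rho -> rho `^ q <= e.
Proof.
move=> q0 e0; pose b := e `^ q^-1.
have b0 : 0 < b by exact: powR_gt0.
have -> : e = b `^ q by rewrite /b -powRrM mulVf ?powRr1 ?(ltW e0)// lt_eqF.
exists b => // rho brho; have rho0 : 0 < rho := lt_le_trans b0 brho.
clearbody b; rewrite -[q]opprK !(powRN _ (- q)) lef_pV2 ?posrE ?powR_gt0//.
have h1 : 0 <= - q by rewrite oppr_ge0 ltW.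
have h2 : b \in Num.nneg by rewrite nnegrE ltW.
have h3 : rho \in Num.nneg by rewrite nnegrE ltW.
exact: (ge0_ler_powR h1 h2 h3 brho).
Qed.

Section HemispherePowers.
Context {R : realType} (n : nat).
Local Notation RN N := (N.-tuple (measurableTypeR R)).

Lemma measurable_last_coord_pow (mu : R) (D : set (RN n.+1)) :
  measurable_fun D (fun t => last_coord (row_of t) `^ mu).
Proof.
apply: measurable_funTS.
exact: (measurableT_comp (@measurable_powR R mu) (@measurable_last_coord R n)).
Qed.

Lemma hemisphere_power_integrable (mu rho : R) : -1 < mu -> 0 < rho ->
  (sphere_area n.+1 rho).-integrable (upper_hemisphere n rho)
    (fun t => (last_coord (row_of t) `^ mu)%:E).
Proof.
move=> mu1 rho0; apply/integrableP; split.
  by apply/measurable_EFinP; exact: measurable_last_coord_pow.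
under eq_integral do rewrite gee0_abs ?lee_fin ?powR_ge0//.
rewrite hemisphere_power_scale// lte_mul_pinfty ?lee_fin ?powR_ge0//.
exact: hemisphere_power_lty.
Qed.

Lemma hemisphere_power_Rintegral (mu rho : R) : -1 < mu -> 0 < rho ->
  \int[sphere_area n.+1 rho]_(t in upper_hemisphere n rho) (last_coord (row_of t) `^ mu)
  = rho `^ (n%:R + mu) * sigma n mu.
Proof.
move=> mu1 rho0; rewrite /Rintegral hemisphere_power_scale// fineM//.
by rewrite ge0_fin_numE ?hemisphere_power_lty// integral_ge0// => t _; rewrite lee_fin powR_ge0.
Qed.

Lemma sigma_ge0 (mu : R) : 0 <= sigma n mu.
Proof. by apply: Rintegral_ge0 => t _; exact: powR_ge0. Qed.

End HemispherePowers.

Lemma sphere_total_integral (R : realType) (n : nat) (rho : R) : 0 < rho -> (0 < n)%N ->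
  (\int[sphere_area n rho]_(t in @sphere R n rho) (1 : R)%:E =
   (rho ^+ n.-1 * fine (\int[sphere_area n 1]_(t in @sphere R n 1) (1 : R)%:E))%:E)%E.
Proof.
case: n => // N rho0 _; have [-> lty] := sphere_total_scale N rho0.
by rewrite [RHS]EFinM fineK// ge0_fin_numE// integral_ge0.
Qed.

Section Mass.
Context {R : realType} {n : nat} (X : smms R n) (phi : chart R n (smms_space X)) (a s : R).
Context (asymp : asymptotically_Schwarzschild phi a s).
Context (weight_cases : 0 <= weight X < 1 \/ (-1 < weight X < 0 /\ refined_metric_error phi a s)).
Local Notation RN N := (N.-tuple (measurableTypeR R)).
Local Notation e_ i := (delta_mx 0 i : 'rV[R]_n.+1).
Local Notation U := (interior_end n).
Local Notation m := (weight X).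
Local Notation r x := (enorm x).
Local Notation z x := (last_coord x).
Local Notation A := ((m + n%:R) * (m + n%:R - 1) * a).

Lemma weight_gtN1 : -1 < m.
Proof. by case: weight_cases => [|[]] /andP[]; lra. Qed.

(** The hemisphere lies in the open set [U], so every [partial] may be replaced by an ordinary
    derivative, which is measurable as a limit of difference quotients of a continuous function. *)
Lemma measurable_bulk rho : 1 < rho ->
  measurable_fun (upper_hemisphere n rho) (fun t : RN n.+1 => bulk_integrand phi (row_of t)).
Proof.
move=> rho1.
pose DU : set (RN n.+1) := [set t | U (row_of t)].
have mz : measurable_fun setT (fun t : RN n.+1 => z (row_of t)) := @measurable_last_coord R n.
have mr : measurable_fun setT (fun t : RN n.+1 => r (row_of t)) := @measurable_row_of_enorm R n.+1.
have mDU : measurable DU.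
  rewrite (_ : DU = ((fun t => z (row_of t)) @^-1` `]0%R, +oo[) `&`
                   ((fun t => r (row_of t)) @^-1` `]1%R, +oo[)); last first.
    by apply/seteqP; split => t /=; rewrite !in_itv/= !andbT.
  by apply: measurableI; rewrite -[X in measurable X]setTI; [exact: mz|exact: mr].
have HU : upper_hemisphere n rho `<=` DU by move=> t [rE z0]; split; rewrite ?rE.
apply: (measurable_funS mDU HU).
pose mp := metric_pert phi; pose dp := density_pert phi.
pose MF i x := \sum_(j < n.+1) ('D_(e_ j) (mp i j) x - 'D_(e_ i) (mp j j) x)
  + m * (z x)^-1 * mp ord_max i x - 2 * m * (z x)^-1 * 'D_(e_ i) dp x.
apply: (@eq_measurable_fun _ _ _ _ _ (fun t : RN n.+1 =>
   (\sum_(i < n.+1) MF i (row_of t) * (tnth t i / r (row_of t))) * z (row_of t) `^ m)).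
  move=> t /set_mem tU; rewrite /bulk_integrand; congr (_ * _); apply: eq_bigr => i _.
  have [z0 r1] := tU; have r0 : 0 < r (row_of t) by apply: lt_trans r1.
  have tE := interior_end_nbhs tU.
  have xi : row_of t 0 i = tnth t i by rewrite mxE.
  have S : \sum_(j < n.+1) (partial (exterior R n) (metric_pert phi i j) j (row_of t) -
      partial (exterior R n) (metric_pert phi j j) i (row_of t)) =
    \sum_(j < n.+1) ('D_(e_ j) (mp i j) (row_of t) - 'D_(e_ i) (mp j j) (row_of t)).
    by apply: eq_bigr => j _; rewrite !(partial_interior _ _ tE).
  have ME : mass_form phi i (row_of t) = MF i (row_of t).
    by rewrite /mass_form S (partial_interior (density_pert phi) i tE).
  by rewrite xi ME.
have miz : measurable_fun DU (fun t : RN n.+1 => (z (row_of t))^-1).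
  apply: measurable_funV_gt0; first exact: measurable_funTS.
  by move=> t [].
have mpow q : measurable_fun DU (fun t : RN n.+1 => z (row_of t) `^ q).
  exact: measurable_last_coord_pow.
have mD (f : 'rV[R]_n.+1 -> R) k : (forall x, U x -> {for x, continuous f}) -> (forall x, U x -> derivable f x (e_ k)) ->
    measurable_fun DU (fun t : RN n.+1 => 'D_(e_ k) f (row_of t)).
  by move=> cf df; apply: measurable_derive_row => //; exact: open_interior_end.
have mDmp i j k : measurable_fun DU (fun t : RN n.+1 => 'D_(e_ k) (mp i j) (row_of t)).
  apply: mD => x xU; first exact: (metric_pert_continuous asymp).
  have [C C0 /(_ i j x xU)[_ _ /(_ k)[[d _] _]]] := metric_expansion asymp.
  exact: d.
have mDdp k : measurable_fun DU (fun t : RN n.+1 => 'D_(e_ k) dp (row_of t)).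
  apply: mD => x xU; first exact: (density_pert_continuous asymp).
  have [h [C C0 /(_ x xU)[_ _ /(_ k)[[d _] _ _]]]] := density_expansion asymp.
  exact: d.
have mmp i j : measurable_fun DU (fun t : RN n.+1 => mp i j (row_of t)).
  by apply: measurable_continuous_row => t; exact: (metric_pert_continuous asymp).
apply: measurable_funM => //.
apply: measurable_sum => i; apply: measurable_funM; last first.
  apply: measurable_funM.
    apply: measurable_funTS.
    exact: (@measurable_tnth _ (measurableTypeR R) n.+1 i).
  apply: measurable_funV_gt0; first exact: measurable_funTS.
  by move=> t [_]; exact: lt_trans.
apply: measurable_funB.
  apply: measurable_funD.
    by apply: measurable_sum => j; apply: measurable_funB.
  apply: measurable_funM => //; apply: measurable_funM => //; exact: measurable_cst.
apply: measurable_funM => //; apply: measurable_funM => //; exact: measurable_cst.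
Qed.

(** The leading part integrates to exactly [A * sigma n m], since its factor [rho^(-n-m)] cancels
    the growth [rho^(n+m)] of the hemisphere integral. The error integrates to at most a multiple of
    [rho^(s-n-1-nu) rho^(n+nu) = rho^(s-1)]; the same domination gives integrability of the
    integrand. *)
Lemma bulk_integral : exists2 K : R, 0 <= K & forall rho, 1 < rho ->
  (sphere_area n.+1 rho).-integrable (upper_hemisphere n rho)
        (fun t => (bulk_integrand phi (row_of t))%:E) /\
  `|\int[sphere_area n.+1 rho]_(t in upper_hemisphere n rho) bulk_integrand phi (row_of t)
    - A * sigma n m| <= K * rho `^ (s - 1).
Proof.
have [nu [nu1 [K K0 HK]]] := bulk_estimate asymp weight_cases.
have m1 := weight_gtN1.
exists (K * sigma n nu); first by rewrite mulr_ge0 ?sigma_ge0// ltW.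
move=> rho rho1; have rho0 : 0 < rho by lra.
have mH := @measurable_upper_hemisphere R n rho.
have mb := measurable_bulk rho1.
have im := hemisphere_power_integrable n m1 rho0.
have inu := hemisphere_power_integrable n nu1 rho0.
pose c1 := A * rho `^ (- n%:R - m); pose c2 := K * rho `^ (s - n%:R - 1 - nu).
pose mu := sphere_area n.+1 rho : {measure set RN n.+1 -> \bar R}.
pose H := @upper_hemisphere R n rho.
pose b (t : RN n.+1) := bulk_integrand phi (row_of t).
pose f1 (t : RN n.+1) := c1 * z (row_of t) `^ m.
pose f2 (t : RN n.+1) := c2 * z (row_of t) `^ nu.
have i1 : mu.-integrable H (EFin \o f1).
  exact: (integrableZl mH c1 im).
have i2 : mu.-integrable H (EFin \o f2).
  exact: (integrableZl mH c2 inu).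
have est t : H t -> `|b t - f1 t| <= f2 t.
  move=> [rE z0]; have tU : U (row_of t) by split; rewrite ?rE.
  by have := HK _ tU; rewrite rE.
have mf1 : measurable_fun H f1 by apply: measurable_funM => //; exact: measurable_last_coord_pow.
have id : mu.-integrable H (EFin \o (fun t => b t - f1 t)).
  apply: (le_integrable mH _ _ i2).
    by apply/measurable_EFinP; apply: measurable_funB.
  by move=> t Ht /=; rewrite lee_fin; apply: le_trans (est t Ht) (ler_norm _).
have ib : mu.-integrable H (EFin \o b).
  have := integrableD mH id i1; apply: eq_integrable => // t _ /=.
  by rewrite -EFinD subrK.
split; first exact: ib.
have I1 : \int[mu]_(t in H) f1 t = c1 * \int[mu]_(t in H) (z (row_of t) `^ m).
  exact: RintegralZl.
have I2 : \int[mu]_(t in H) f2 t = c2 * \int[mu]_(t in H) (z (row_of t) `^ nu).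
  exact: RintegralZl.
have -> : A * sigma n m = \int[mu]_(t in H) f1 t.
  have E : rho `^ (- n%:R - m) * rho `^ (n%:R + m) = 1.
    rewrite -powRD ?(gt_eqF rho0) ?implybT//.
    by rewrite (_ : - n%:R - m + _ = 0) ?powRr0//; ring.
  rewrite I1 (hemisphere_power_Rintegral n m1 rho0) /c1.
  have gen (x y w v : R) : y * w = 1 -> x * v = x * y * (w * v).
    by move=> yw; rewrite -mulrA [y * _]mulrA yw mul1r.
  exact: gen.
rewrite -[X in `|X - _|]/(\int[mu]_(t in H) b t) -(RintegralB mH ib i1).
apply: le_trans (le_normr_Rintegral mH id) _.
have -> : K * sigma n nu * rho `^ (s - 1) = \int[mu]_(t in H) f2 t.
  rewrite I2 (hemisphere_power_Rintegral n nu1 rho0) /c2.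
  have -> : rho `^ (s - 1) = rho `^ (s - n%:R - 1 - nu) * rho `^ (n%:R + nu).
    by rewrite -powRD ?(gt_eqF rho0) ?implybT//; congr (_ `^ _); ring.
  by ring.
apply: le_Rintegral => //.
have := integrable_abse id; apply: eq_integrable => // t _.
Qed.

Lemma append_coord_last (x : 'rV[R]_n) t : z (append_coord x t) = t.
Proof. by rewrite /last_coord mxE unlift_none. Qed.

Lemma append_coord_lift (x : 'rV[R]_n) t k : append_coord x t 0 (lift ord_max k) = x 0 k.
Proof. by rewrite mxE liftK. Qed.

Lemma append_coord_shift (x : 'rV[R]_n) t :
  append_coord x t = append_coord x 0 + t *: e_ ord_max.
Proof.
apply/rowP => i; rewrite !mxE eqxx/=; have [k ->|->] := unliftP ord_max i.
  by rewrite eq_sym (negbTE (neq_lift ord_max k)) mulr0 addr0.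
by rewrite eqxx mulr1 add0r.
Qed.

Lemma enorm_append_coord (x : 'rV[R]_n) t : enorm x <= r (append_coord x t).
Proof.
rewrite /enorm; apply: ler_wsqrtr; rewrite big_ord_recr/= -[leLHS]addr0.
apply: lerD; last exact: sqr_ge0.
rewrite le_eqVlt; apply/orP; left; apply/eqP; apply: eq_bigr => k _.
by rewrite -(append_coord_lift x t); congr (append_coord x t 0 _ ^+ 2); apply/val_inj;
  rewrite /= /bump leqNgt ltn_ord.
Qed.

Lemma append_coord_exterior (x : 'rV[R]_n) t : 1 < enorm x -> 0 <= t ->
  exterior R n (append_coord x t).
Proof.
move=> x1 t0; split; first by rewrite append_coord_last.
exact: lt_le_trans (enorm_append_coord x t).
Qed.

Lemma append_coord_interior (x : 'rV[R]_n) t : 1 < enorm x -> 0 < t -> U (append_coord x t).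
Proof.
move=> x1 t0; split; first by rewrite append_coord_last.
exact: lt_le_trans (enorm_append_coord x t).
Qed.

Lemma metric_pert_offdiag k x :
  metric_pert phi ord_max (lift ord_max k) x = metric_error phi a ord_max (lift ord_max k) x.
Proof. by rewrite /metric_pert /metric_error (negbTE (neq_lift ord_max k)) !mulr0. Qed.

Lemma ord_ratio_bound (x : 'rV[R]_n.+1) (f : 'I_n -> R) (B : R) :
  (forall k, `|f k| <= B) ->
  `|\sum_(k < n) f k * (x 0 (lift ord_max k) / r x)| <= n%:R * B.
Proof.
move=> fB; apply: le_trans (ler_norm_sum _ _ _) _.
rewrite mulr_natl (_ : B *+ n = \sum_(k < n) B); last by rewrite sumr_const card_ord.
apply: ler_sum => i _.
by rewrite normrM; apply: le_trans (fB i); rewrite ler_piMr// ratio_le1.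
Qed.

(** The one-sided normal quotient converges, so the value at height [t] differs from the boundary
    value by [t] times a convergent quantity. *)
Lemma partial_right_cvg (f : 'rV[R]_n.+1 -> R) (x : 'rV[R]_n) : 1 < enorm x ->
  has_partial (exterior R n) f ord_max (append_coord x 0) ->
  f (append_coord x t) @[t --> 0^'+] --> f (append_coord x 0).
Proof.
move=> x1 /cvg_ex[l ql]; set x0 := append_coord x 0.
have qr : diff_quotient f ord_max x0 t @[t --> 0^'+] --> l.
  move=> V /ql; rewrite /increments /within/= => qV.
  have qV' : nbhs (0 : R) [set h | h != 0 -> exterior R n (x0 + h *: e_ ord_max) ->
    V (diff_quotient f ord_max x0 h)] := qV.
  have : nbhs (0 : R) [set h | 0 < h -> V (diff_quotient f ord_max x0 h)].
    apply: filterS qV' => h hV h0; apply: hV; first by rewrite gt_eqF.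
    by rewrite -append_coord_shift; apply: append_coord_exterior => //; exact: ltW.
  by [].
have t0 : (fun t : R => t) @ 0^'+ --> (0 : R) by apply: cvg_at_right_filter; exact: cvg_id.
have : f x0 + t * diff_quotient f ord_max x0 t @[t --> 0^'+] --> f x0 + 0 * l.
  by apply: cvgD; [exact: cvg_cst|exact: cvgM].
rewrite mul0r addr0; apply: cvg_trans; apply: near_eq_cvg.
near=> t; have t1 : 0 < t by near: t; exact: nbhs_right_gt.
rewrite append_coord_shift -/x0 /diff_quotient mulrA mulfV ?gt_eqF// mul1r addrC.
by rewrite subrK.
Unshelve. all: by end_near. Qed.

(** Only off-diagonal entries enter, so the integrand is a contraction of the metric error times
    [t^m]. For [m = 0] the limit is its boundary value. For [m > 0] the error is bounded and [t^m]
    tends to 0. For [m < 0] the diagonal part [E0] drops out and the rest, [t E1], leaves [t^(m+1)],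
    which also tends to 0. *)
Lemma boundary_facts : exists2 K : R, 0 <= K & forall x : 'rV[R]_n, 1 < enorm x ->
  exists2 L, boundary_integrand phi x t @[t --> 0^'+] --> L &
             `|L| <= K * enorm x `^ (s - n%:R).
Proof.
have n1 := @weight_gt1 _ _ X; have [_ /andP[s0 s1] O _] := asymp; have m1 := weight_gtN1.
have [C [C0 HC]] : exists C : R, 0 < C /\ forall k x, exterior R n x ->
    `|metric_error phi a ord_max (lift ord_max k) x| <= C * r x `^ (s - n%:R - m).
  have [C C0 HC] := @uniform_constant R 'I_n (fun k c => forall x, exterior R n x ->
      `|metric_error phi a ord_max (lift ord_max k) x| <= c * r x `^ (s - n%:R - m))
    (fun i c c' cc' H x xU => le_trans (H x xU) (ler_wpM2r (powR_ge0 _ _) cc'))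
    (fun k => let: ex_intro2 c c0 H := O ord_max (lift ord_max k) in
     ex_intro2 _ _ c c0 (fun x xU => (H x xU).1)).
  by exists C.
have bE x t : boundary_integrand phi x t =
    (\sum_(k < n) metric_error phi a ord_max (lift ord_max k) (append_coord x t)
     * (append_coord x t 0 (lift ord_max k) / r (append_coord x t))) * t `^ m.
  by congr (_ * _); apply: eq_bigr => k _; rewrite metric_pert_offdiag.
have [m0|m0] := eqVneq m 0.
  exists (n%:R * C); first by rewrite mulr_ge0// ltW.
  move=> x x1; set x0 := append_coord x 0.
  have x0E : exterior R n x0 by exact: append_coord_exterior.
  have r0 : 0 < r x0 by apply: lt_trans x0E.2.
  have rx : r x0 = enorm x.
    apply/eqP; rewrite eq_le enorm_append_coord andbT /enorm; apply: ler_wsqrtr.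
    rewrite big_ord_recr/= -/(last_coord x0) append_coord_last expr0n addr0.
    apply: ler_sum => k _; rewrite -(append_coord_lift x 0).
    rewrite le_eqVlt; apply/orP; left; apply/eqP; congr (append_coord x 0 0 _ ^+ 2).
    by apply/val_inj; rewrite /= /bump leqNgt ltn_ord.
  exists (\sum_(k < n) metric_error phi a ord_max (lift ord_max k) x0
     * (x0 0 (lift ord_max k) / r x0)); last first.
    have := ord_ratio_bound x0 (fun k => HC k _ x0E).
    by rewrite m0 subr0 rx mulrA.
  have t0 : (fun t : R => t) @ 0^'+ --> (0 : R) by apply: cvg_at_right_filter; exact: cvg_id.
  have ax : append_coord x t @[t --> 0^'+] --> x0.
    apply: cvg_row => i; have [k ->|->] := unliftP ord_max i.
      by under eq_fun do rewrite append_coord_lift; rewrite append_coord_lift; exact: cvg_cst.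
    under eq_fun do rewrite -/(last_coord _) append_coord_last.
    by rewrite -/(last_coord _) append_coord_last.
  have rc : r (append_coord x t) @[t --> 0^'+] --> r x0.
    by move=> V /(@enorm_continuous _ _ x0) VV; exact: (ax _ VV).
  rewrite (_ : boundary_integrand phi x = (fun t => \sum_(k < n)
     metric_error phi a ord_max (lift ord_max k) (append_coord x t)
     * (x0 0 (lift ord_max k) / r (append_coord x t)))); last first.
    apply/funext => t; rewrite bE m0 powRr0 mulr1; apply: eq_bigr => k _.
    by rewrite !append_coord_lift.
  apply: (@cvg_big _ _ _ _ _ add_continuous) => k _; apply: cvgM.
    apply: partial_right_cvg => //.
    have [c c0 H] := O ord_max (lift ord_max k).
    by have [_ /(_ ord_max)[]] := H x0 x0E.
  apply: cvgM; first exact: cvg_cst.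
  by apply: cvgV => //; rewrite gt_eqF.
have [q [q0 [K K0 HK]]] : exists q : R, 0 < q /\ exists2 K : R, 0 <= K &
    forall x t, 1 < enorm x -> 0 < t -> `|boundary_integrand phi x t| <= K * t `^ q.
  have [m2|m2] := ltP 0 m.
    exists m; split => //; exists (n%:R * C); first by rewrite mulr_ge0// ltW.
    move=> x t x1 t0; rewrite bE normrM [X in _ * X]ger0_norm ?powR_ge0//.
    rewrite ler_wpM2r ?powR_ge0//; apply: ord_ratio_bound => k.
    have xE := append_coord_exterior x1 (ltW t0).
    apply: le_trans (HC k _ xE) _; rewrite ler_piMr ?(ltW C0)// enorm_pow_le1//.
      exact: xE.2.
    lra.
  have [_ [E0 [E1 [OE0 OE1 HEE]]]] : -1 < m < 0 /\ refined_metric_error phi a s.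
    by case: weight_cases => // /andP[m3 _]; move: m0; rewrite eq_le m2 m3.
  have [C3 C30 HE1] := @uniform_constant R 'I_n
    (fun k c => forall x, U x -> `|E1 ord_max (lift ord_max k) x| <= c * r x `^ (s - n%:R - m - 1))
    (fun i c c' cc' H x xU => le_trans (H x xU) (ler_wpM2r (powR_ge0 _ _) cc'))
    (fun k => let: ex_intro2 c c0 H := bigO'_interior (OE1 ord_max (lift ord_max k)) in
     ex_intro2 _ _ c c0 (fun x xU => (H x xU).1)).
  exists (m + 1); split; first by lra.
  exists (n%:R * C3); first by rewrite mulr_ge0// ltW.
  move=> x t x1 t0; have xU := append_coord_interior x1 t0.
  rewrite bE normrM [`|t `^ m|]ger0_norm ?powR_ge0//.
  have -> : t `^ (m + 1) = t * t `^ m.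
    by rewrite powRD ?(gt_eqF t0) ?implybT// powRr1 ?(ltW t0)// mulrC.
  rewrite mulrA ler_wpM2r ?powR_ge0// -mulrA; apply: ord_ratio_bound => k.
  rewrite (HEE _ _ _ (interior_end_exterior xU)) (negbTE (neq_lift ord_max k)) mulr0 add0r.
  rewrite append_coord_last normrM (gtr0_norm t0) mulrC ler_wpM2r ?(ltW t0)//.
  apply: le_trans (HE1 k _ xU) _; rewrite ler_piMr ?(ltW C30)// enorm_pow_le1//.
    exact: xU.2.
  lra.
(* The trace vanishes when [m] is nonzero, so the constant may be 0. *)
exists 0 => // x x1; exists 0; last by rewrite normr0 mul0r.
have Kt : K * t `^ q @[t --> 0^'+] --> (0 : R).
  by rewrite -[X in _ --> X](mulr0 K); apply: cvgM; [exact: cvg_cst|exact: powR_cvg0].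
apply/cvgrPdist_le => /= e e0; have /cvgrPdist_le/(_ e e0) := Kt.
move=> H; near=> t; have t0 : 0 < t by near: t; exact: nbhs_right_gt.
have : `|0 - K * t `^ q| <= e by near: t.
rewrite !sub0r !normrN; apply: le_trans; apply: le_trans (HK x t x1 t0) _.
exact: ler_norm.
Unshelve. all: by end_near. Qed.

(** A trace of size [rho^(s-n)] on a sphere of area proportional to [rho^(n-1)] contributes
    [O(rho^(s-1))], which disappears in the limit. *)
Lemma boundary_integral : (0 < n)%N -> exists2 K : R, 0 <= K & forall rho, 1 < rho ->
  [/\ forall t, sphere n rho t -> cvg (boundary_integrand phi (row_of t) u @[u --> 0^'+]),
     (sphere_area n rho).-integrable (sphere n rho)
        (fun t => (boundary_trace phi (row_of t))%:E) &
     `|\int[sphere_area n rho]_(t in sphere n rho) boundary_trace phi (row_of t)|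
        <= K * rho `^ (s - 1)].
Proof.
move=> n0; have [K K0 HK] := boundary_facts.
pose w := fine (\int[sphere_area n 1]_(t in @sphere R n 1) (1 : R)%:E)%E.
have tot rho (rho0 : 0 < rho) := sphere_total_integral rho0 n0.
have w0 : 0 <= w by rewrite /w fine_ge0// integral_ge0// => t _; rewrite lee_fin.
exists (K * w); first exact: mulr_ge0.
move=> rho rho1; have rho0 : 0 < rho by lra.
have mS := @measurable_sphere R n rho.
have cv t : sphere n rho t -> boundary_integrand phi (row_of t) u @[u --> 0^'+] -->
    boundary_trace phi (row_of t).
  move=> tS; have x1 : 1 < enorm (row_of t) by rewrite tS.
  have [L LL _] := HK _ x1; rewrite /boundary_trace (cvg_lim _ LL)//.
have bt t : sphere n rho t -> `|boundary_trace phi (row_of t)| <= K * rho `^ (s - n%:R).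
  move=> tS; have x1 : 1 < enorm (row_of t) by rewrite tS.
  by have [L LL] := HK _ x1; rewrite /boundary_trace (cvg_lim _ LL)// tS.
have mb : measurable_fun (sphere n rho) (fun t : RN n => boundary_trace phi (row_of t)).
  (* The trace is the limit along the heights [1 / (k + 1)]; at each positive height the point lies
     in [U], where the integrand is continuous. *)
  apply: (@measurable_fun_cvg _ _ _ _ (fun k t => boundary_integrand phi (row_of t) k.+1%:R^-1)).
    move=> k; have k0 : 0 < k.+1%:R^-1 :> R by rewrite invr_gt0.
    apply: (@measurable_continuous_row R n _ (fun x => boundary_integrand phi x k.+1%:R^-1)) => t tS.
    have x1 : 1 < enorm (row_of t) by rewrite tS.
    set x := row_of t; set h := k.+1%:R^-1.
    have xU := append_coord_interior x1 k0.
    have FF : Filter (nbhs x) := nbhs_filter x.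
    have ax : append_coord y h @[y --> x] --> append_coord x h.
      apply: (@cvg_row _ _ _ (nbhs x)) => i; have [l ->|->] := unliftP ord_max i.
        by under eq_fun do rewrite append_coord_lift; rewrite append_coord_lift; exact: coord_continuous.
      under eq_fun do rewrite -/(last_coord _) append_coord_last.
      by rewrite -/(last_coord _) append_coord_last; exact: cvg_cst.
    apply: cvgM; last exact: cvg_cst.
    apply: (@cvg_big _ _ _ _ _ add_continuous) => l _; apply: cvgM.
      by move=> V /(metric_pert_continuous asymp xU) VV; exact: (ax _ VV).
    apply: cvgM.
      under eq_fun do rewrite append_coord_lift; rewrite append_coord_lift.
      exact: coord_continuous.
    apply: cvgV; first by rewrite gt_eqF// (lt_trans _ xU.2).
    by move=> V /(@enorm_continuous _ _ (append_coord x h)) VV; exact: (ax _ VV).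
  move=> t tS; have seqr : k.+1%:R^-1 @[k --> \oo] --> (0 : R)^'+.
    move=> V nV; have nV' : nbhs (0 : R) [set u | 0 < u -> V u] := nV.
    have hk : k.+1%:R^-1 @[k --> \oo] --> (0 : R).
      by apply/cvgrPdist_lt => e0 e00; near=> k; rewrite sub0r normrN gtr0_norm ?invr_gt0//; near: k; exact: (near_infty_natSinv_lt (PosNum e00)).
    have H : \forall k \near \oo, (0 : R) < k.+1%:R^-1 -> V (k.+1%:R^-1) := hk _ nV'.
    by apply: filterS H => k; apply; rewrite invr_gt0.
  exact: (cvg_comp _ _ seqr (cv t tS)).
pose c := K * rho `^ (s - n%:R).
have c0 : 0 <= c by rewrite mulr_ge0// powR_ge0.
have ic : (sphere_area n rho).-integrable (sphere n rho) (EFin \o (fun=> c)).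
  apply/integrableP; split; first by apply/measurable_EFinP; exact: measurable_cst.
  under eq_integral do rewrite /= ger0_norm// -[c]mulr1 EFinM.
  by rewrite ge0_integralZl// tot// -EFinM ltry.
have ib : (sphere_area n rho).-integrable (sphere n rho)
    (EFin \o (fun t => boundary_trace phi (row_of t))).
  apply: (le_integrable mS _ _ ic); first exact/measurable_EFinP.
  by move=> t tS /=; rewrite lee_fin (ger0_norm c0); exact: bt.
split; first by move=> t tS; exact: cvgP (cv t tS).
  exact: ib.
apply: le_trans (le_normr_Rintegral mS ib) _.
apply: (@le_trans _ _ (\int[sphere_area n rho]_(t in sphere n rho) c)).
  apply: le_Rintegral => //.
  exact: (integrable_abse ib).
have -> : \int[sphere_area n rho]_(t in sphere n rho) c = c * (rho ^+ n.-1 * w).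
  rewrite /Rintegral; under eq_integral do rewrite -[c]mulr1 EFinM.
  by rewrite ge0_integralZl// tot.
have -> : rho `^ (s - 1) = rho `^ (s - n%:R) * rho ^+ n.-1.
  rewrite -powR_mulrn ?(ltW rho0)// -powRD ?(gt_eqF rho0) ?implybT//.
  by congr (_ `^ _); case: n n0 => // N _; rewrite -natr1 /=; ring.
by rewrite /c le_eqVlt; apply/orP; left; apply/eqP; ring.
Unshelve. all: by end_near. Qed.

Lemma flux_cvg : (0 < n)%N ->
  (\forall rho \near +oo, flux_defined phi rho) /\
  flux phi rho @[rho --> +oo] --> A * sigma n m.
Proof.
move=> n0; have [_ /andP[s0 s1] _ _] := asymp.
have [K1 K10 H1] := bulk_integral; have [K2 K20 H2] := boundary_integral n0.
split.
  near=> rho; have rho1 : 1 < rho by near: rho; apply: nbhs_pinfty_gt; rewrite num_real.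
  by have [h1 _] := H1 _ rho1; have [h2 h3 _] := H2 _ rho1.
apply/cvgrPdist_le => /= e e0.
have K0 : 0 < K1 + K2 + 1 by lra.
have eK : 0 < e / (K1 + K2 + 1) by rewrite divr_gt0.
have s10 : s - 1 < 0 by lra.
have [B B0 HB] := powR_small s10 eK.
near=> rho; have rho1 : 1 < rho by near: rho; apply: nbhs_pinfty_gt; rewrite num_real.
have rhoB : B <= rho by near: rho; apply: nbhs_pinfty_ge; rewrite num_real.
have [_ h1] := H1 _ rho1; have [_ _ h2] := H2 _ rho1.
have := HB _ rhoB; rewrite ler_pdivlMr// => h3.
have p0 : 0 <= rho `^ (s - 1) := powR_ge0 _ _.
rewrite distrC /flux addrAC; apply: le_trans (ler_normD _ _) _.
apply: le_trans (lerD h1 h2) _; apply: le_trans h3.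
by rewrite -mulrDl mulrC ler_wpM2l//; lra.
Unshelve. all: by end_near. Qed.

Lemma mass_formula : (0 < n)%N ->
  [/\ mass_exists phi, sigma_integrable n m & mass phi = A * sigma n m].
Proof.
move=> n0; have [h1 h2] := flux_cvg n0; split.
- by split => //; exact: cvgP h2.
- exact: hemisphere_power_integrable weight_gtN1 ltr01.
- exact: cvg_lim h2.
Qed.

End Mass.


(** * The coefficient is intrinsic *)

Section Invariance.
Context {R : realType} {n : nat} (X : smms R n).
Local Notation e_ i := (delta_mx 0 i : 'rV[R]_n.+1).
Local Notation U := (interior_end n).

Lemma within_nbhs_cvg (T V : topologicalType) (D : set T) (f : T -> V) x :
  nbhs x D -> {within D, continuous f} -> f y @[y --> x] --> f x.
Proof.
move=> xD /subspace_continuousP cf.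
have fx := cf x (nbhs_singleton xD).
move=> A /fx H; have H' : nbhs x [set y | D y -> A (f y)] := H.
by apply: filterS2 xD H' => y Dy; apply.
Qed.

(** The differential of the density in the coordinates of [phi]: no index is raised here, the
    inverse metric enters in [gradient_sq]. *)
Definition gradient (phi : chart R n X) (x : 'rV[R]_n.+1) : 'cV[R]_n.+1 :=
  \col_i partial (exterior R n) (push_density phi) i x.

Definition gradient_sq (phi : chart R n X) (x : 'rV[R]_n.+1) : R :=
  ((gradient phi x)^T *m invmx (push_metric phi x) *m gradient phi x) 0 0.

(* [gradient_sq] computed in the chart of the atlas at [P]: it no longer depends
   on the asymptotic coordinates. *)
Definition chart_gradient_sq (P : X) : R :=
  let c := chart_at P in let u := chart_coord c P in
  let D := \col_k partial (chart_cod c) (fun y => density (chart_point c y)) k u in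
  (D^T *m invmx (met X c u) *m D) 0 0.

Lemma chart_coordK (M : topologicalType) (c : chart R n M) x : is_chart c ->
  chart_cod c x -> chart_dom c (chart_point c x) /\ chart_coord c (chart_point c x) = x.
Proof. by move=> [_ _ H _ _] [P cP <-]; rewrite H. Qed.

Section AtPoint.
Context (phi : chart R n X) (phi_end : end_diffeo phi).
Context (x : 'rV[R]_n.+1) (xU : U x) (dx : density (chart_point phi x) != 0).
Let P := chart_point phi x.
Let c := chart_at P.
Let u := chart_coord c P.
Let fc := fun y => density (chart_point c y).
Let T := transition phi c.

Lemma atlas_c : @atlas _ _ X c. Proof. exact: chart_at_atlas. Qed.

Lemma overlap_nbhs : nbhs x (overlap phi c `&`
   [set y | push_density phi y = fc (T y)]).
Proof.
have [chphi _ codE _] := phi_end; have chc := atlas_charts atlas_c.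
have xE := interior_end_nbhs xU.
have xcod : nbhs x (chart_cod phi) by rewrite codE.
have [_ _ _ _ cpt] := chphi.
have Pc : nbhs P (chart_dom c).
  by apply: open_nbhs_nbhs; split; [case: chc|exact: chart_at_dom].
have H := within_nbhs_cvg xcod cpt Pc.
apply: filterS2 xcod H => y yc Py.
have [d1 d2] := chart_coordK chphi yc.
split; first by exists (chart_point phi y).
by rewrite /= /push_density /fc /T /transition; case: chc => _ _ -> .
Qed.

(** If the last coordinate of [u] were 0, then [P] would be a boundary point and its density would
    vanish. Positivity of the density thus places [u] in the interior, where partial derivatives in
    the atlas chart are ordinary. *)
Lemma chart_cod_nbhs : nbhs u (chart_cod c).
Proof.
have chc := atlas_charts atlas_c.
have uc : chart_cod c u by exists P => //; exact: chart_at_dom.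
have [_ [V oV cE] _ _ _] := chc.
have [uV u0] : (V `&` half_space R n) u by rewrite -cE.
have un0 : last_coord u != 0.
  apply: contra dx => /eqP u00; apply/eqP.
  have : (@density _ _ X @^-1` [set 0]) P.
    by rewrite density_zero; exists c; split => //; [exact: atlas_c|exact: chart_at_dom].
  by [].
have u1 : 0 < last_coord u by rewrite lt_neqAle eq_sym un0.
have lc : last_coord y @[y --> u] --> last_coord u by exact: coord_continuous.
rewrite cE; apply: filterS2 (open_nbhs_nbhs (conj oV uV)) (lc _ (lt_nbhsr u1)) => y yV y0.
by split => //; exact: ltW.
Qed.

(** Near [x] the density in the coordinates of [phi] is [fc] composed with [T], and [derive_path]
    applies to the images under [T] of the coordinate lines through [x]. *)
Lemma gradient_chain : gradient phi x = (Defs.jacobian (overlap phi c) T x)^T *m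
  (\col_k partial (chart_cod c) fc k u).
Proof.
have [chphi _ codE comp] := phi_end; have chc := atlas_charts atlas_c.
have ov := overlap_nbhs; have xE := interior_end_nbhs xU.
have xov : nbhs x (overlap phi c) by apply: filterS ov => y [].
have uc := chart_cod_nbhs.
have sf : smooth_on (chart_cod c) fc := density_smooth atlas_c.
have [sT _] := comp c atlas_c.
have Tx : T x = u by [].
apply/colP => i; rewrite !mxE (partial_interior _ _ xE).
have dT k : is_derive (0 : R) 1 (fun t => T (x + t *: e_ i) 0 k)
    (Defs.jacobian (overlap phi c) T x k i).
  have [_ /(_ i x (nbhs_singleton xov))] := sT k [::].
  move=> /(has_partial_interior _ _ xov) dd.
  rewrite mxE (partial_interior _ _ xov).
  apply: (@is_derive_line _ _ (fun y => T y 0 k)); rewrite scale0r addr0.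
  exact: DeriveDef.
have df : \forall y \near u, forall k, derivable fc y (e_ k).
  apply: filterS (nbhs_interior uc) => y yc k.
  have [_ /(_ k y (nbhs_singleton yc))] := sf [::].
  by move=> /(has_partial_interior _ _ yc).
have cf k : {for u, continuous (fun y => 'D_(e_ k) fc y)}.
  have [ck _] := sf [:: k].
  have H := within_nbhs_cvg uc ck.
  have NE : \forall y \near u, partial (chart_cod c) fc k y = 'D_(e_ k) fc y.
    by apply: filterS (nbhs_interior uc) => y yc; rewrite (partial_interior _ _ yc).
  move=> A; rewrite /= -(partial_interior fc k uc) => /H HA.
  have HA' : nbhs u [set y | A (partial (chart_cod c) fc k y)] := HA.
  by apply: filterS2 NE HA' => y /= ->.
have g0 : T (x + 0 *: e_ i) = u by rewrite scale0r addr0.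
have D1 := derive_path df cf g0 dT.
have D2 : is_derive x (e_ i) (fc \o T) (\sum_k 'D_(e_ k) fc u * Defs.jacobian (overlap phi c) T x k i).
  exact: is_derive_lineV D1.
have [_ ->] : is_derive x (e_ i) (push_density phi)
    (\sum_k 'D_(e_ k) fc u * Defs.jacobian (overlap phi c) T x k i).
  by apply: is_derive_near D2; apply: filterS ov => y [].
by apply: eq_bigr => k _; rewrite !mxE (partial_interior _ _ uc) mulrC.
Qed.

(** With metric [J^T G J] and differential [J^T D], the Jacobians cancel in the quadratic form.
    Invertibility of [J] and of [G] is read off from the determinant of the product. *)
Lemma gradient_sq_chart : push_metric phi x \in unitmx ->
  gradient_sq phi x = chart_gradient_sq P.
Proof.
rewrite /gradient_sq gradient_chain /push_metric /pullback -/P -/c.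
set J := Defs.jacobian _ _ _; set G := met X c _; set D := \col_k _.
rewrite unitmxE !det_mulmx det_tr unitrM => /andP[/[!unitrM]/andP[JU GU] _].
have JU' : J \in unitmx by rewrite unitmxE.
have JT : J^T \in unitmx by rewrite unitmx_tr.
have GU' : G \in unitmx by rewrite unitmxE.
rewrite /chart_gradient_sq -/c -/u -/fc -/D.
have -> : met X c u = G by [].
have -> : invmx (J^T *m G *m J) = invmx J *m invmx G *m invmx J^T.
  have GJ : J^T *m G *m J \in unitmx by rewrite !unitmx_mul JT GU' JU'.
  have E : invmx J *m invmx G *m invmx J^T *m (J^T *m G *m J) = 1%:M.
    by rewrite !mulmxA (mulmxKV JT) (mulmxKV GU') mulVmx.
  by rewrite -[LHS]mul1mx -E -mulmxA mulmxV// mulmx1.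
by rewrite trmx_mul trmxK !mulmxA (mulmxK JU') (mulmxKV JT).
Qed.

End AtPoint.

Lemma density_continuous : continuous (@density _ _ X).
Proof.
move=> P; pose c := chart_at P; pose u := chart_coord c P.
have cA : @atlas _ _ X c := chart_at_atlas P.
have chc := atlas_charts cA; have cP : chart_dom c P := chart_at_dom P.
have [oc _ ck /subspace_continuousP cc _] := chc.
have [/subspace_continuousP cf _] := density_smooth cA [::].
have Pc : nbhs P (chart_dom c) by exact: open_nbhs_nbhs.
have uc : chart_cod c u by exists P.
move=> A AP.
have fu : density (chart_point c u) = density P by rewrite /u ck.
have H' : nbhs u [set y | chart_cod c y -> A (density (chart_point c y))].
  by apply: (cf u uc A); change (nbhs (density (chart_point c u)) A); rewrite fu.
have H2 := cc P cP _ H'.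
have H2' : nbhs P [set Q | chart_dom c Q ->
  chart_cod c (chart_coord c Q) -> A (density (chart_point c (chart_coord c Q)))] := H2.
apply: filterS2 Pc H2' => Q Qc /(_ Qc); rewrite ck// => QA.
by apply: QA; exists Q.
Qed.

(** Used contrapositively: a point of large density lies outside a given compact set, hence in the
    domain of the other asymptotic chart. *)
Lemma density_bounded (K : set X) : compact K -> exists B : R, forall P, K P -> density P <= B.
Proof.
move=> cK; have : compact (@density _ _ X @` K).
  apply: continuous_compact => //; apply: continuous_subspaceT; exact: density_continuous.
move=> /compact_bounded[M [_ HM]]; exists (M + 1) => P KP.
apply: le_trans (ler_norm _) _; apply: (HM (M + 1)); first by rewrite ltrDl.
by exists P.
Qed.

End Invariance.

(** * Asymptotics of the squared gradient of the density *)

Section GradientAsymptotics.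
Context {R : realType} {n : nat} (X : smms R n) (phi : chart R n X) (a s : R).
Context (asymp : asymptotically_Schwarzschild phi a s).
Local Notation e_ i := (delta_mx 0 i : 'rV[R]_n.+1).
Local Notation U := (interior_end n).
Local Notation m := (weight X).
Local Notation p := (1 - n%:R - m).
Local Notation al := (s - n%:R - m).
Local Notation r x := (enorm x).
Local Notation z x := (last_coord x).

(** From [lam u = w - u E] and [N e <= 1/4], the sums of absolute values satisfy
    [3/4 |u| <= |w| + 1/4 |u|], whence the factor 2. The case [w = 0] gives invertibility. *)
Lemma perturbed_solve N (lam e : R) (E : 'M[R]_N) (u w : 'rV[R]_N) :
  3/4 <= lam -> 0 <= e -> N%:R * e <= 1/4 -> (forall i j, `|E i j| <= e) ->
  u *m (lam%:M + E) = w ->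
  \sum_i `|u 0 i| <= 2 * \sum_i `|w 0 i|.
Proof.
move=> l34 e0 Ne bE uE.
have ui i : lam * u 0 i = w 0 i - \sum_j u 0 j * E j i.
  move/rowP/(_ i): uE; rewrite mulmxDr mul_mx_scalar !mxE => <-.
  by rewrite addrK.
have : lam * \sum_i `|u 0 i| <= \sum_i `|w 0 i| + 1/4 * \sum_i `|u 0 i|.
  apply: (@le_trans _ _ (\sum_i (`|w 0 i| + \sum_j `|u 0 j| * e))).
    rewrite mulr_sumr; apply: ler_sum => i _.
    have -> : lam * `|u 0 i| = `|lam * u 0 i| by rewrite normrM ger0_norm//; lra.
    rewrite ui; apply: le_trans (ler_normB _ _) _; rewrite lerD2l.
    apply: le_trans (ler_norm_sum _ _ _) _; apply: ler_sum => j _.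
    by rewrite normrM ler_wpM2l.
  rewrite big_split/= lerD2l sumr_const card_ord.
  have -> : (\sum_j `|u 0 j| * e) *+ N = N%:R * e * \sum_j `|u 0 j|.
    by rewrite -mulr_suml -mulr_natr; ring.
  by rewrite ler_wpM2r// sumr_ge0.
have : 0 <= \sum_i `|u 0 i| by rewrite sumr_ge0.
set M := \sum_i _; set W := \sum_i _ => M0 H.
have : 3/4 * M <= lam * M by rewrite ler_wpM2r.
by lra.
Qed.

Lemma perturbed_unit N (lam e : R) (E : 'M[R]_N) :
  3/4 <= lam -> 0 <= e -> N%:R * e <= 1/4 -> (forall i j, `|E i j| <= e) ->
  lam%:M + E \in unitmx.
Proof.
move=> l34 e0 Ne bE; rewrite -row_free_unit; apply/inj_row_free => u uE.
have := perturbed_solve l34 e0 Ne bE uE.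
rewrite [X in _ <= _ * X]big1; last by move=> i _; rewrite mxE normr0.
rewrite mulr0 => H; apply/rowP => i; rewrite mxE; apply/eqP; rewrite -normr_le0.
by apply: le_trans H; rewrite (bigD1 i)//= lerDl sumr_ge0.
Qed.

(** Applied with [eta = r^p], [e = a], [w] the differential of the density, [Q] a multiple of
    [r^(s-1)] and [T = a p (x_(n+1) / r)^2]. With [u = w (lam + E)^(-1)] and [q] the quadratic form,
    [lam q = |w|^2 - u E w], so [lam (q - 1) / eta = 2 d_k - e + eta |d|^2 - (u E w) / eta] holds
    exactly. The factor [lam] in the statement avoids expanding its inverse. *)
Lemma perturbed_inner N (k : 'I_N) (lam e Q B T : R) (E : 'M[R]_N) (w d : 'I_N -> R) (eta : R) :
  3/4 <= lam -> 0 < eta <= 1 -> 0 <= Q -> N%:R * (eta * Q) <= 1/4 ->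
  (forall i j, `|E i j| <= eta * Q) -> lam = 1 + e * eta ->
  (forall i, w i = (i == k)%:R + eta * d i) -> (forall i, `|d i| <= B) ->
  `|2 * d k - e - T| <= Q ->
  `|lam * ((((\row_i w i) *m invmx (lam%:M + E) *m (\col_i w i)) 0 0) - 1) / eta - T| <=
   N%:R * B ^+ 2 * eta + (1 + 2 * (N%:R * (1 + B)) ^+ 2) * Q.
Proof.
move=> l34 /andP[eta0 eta1] Q0 Ne bE lamE wE bd dT.
have eQ0 : 0 <= eta * Q by rewrite mulr_ge0// ltW.
have GU := perturbed_unit l34 eQ0 Ne bE.
set u := (\row_i w i) *m invmx (lam%:M + E).
have uE : u *m (lam%:M + E) = \row_i w i by rewrite /u mulmxKV.
have us := perturbed_solve l34 eQ0 Ne bE uE.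
have B0 : 0 <= B := le_trans (normr_ge0 _) (bd k).
have wb i : `|w i| <= 1 + B.
  rewrite wE; apply: le_trans (ler_normD _ _) _; apply: lerD.
    by case: (i == k); rewrite ?normr1 ?normr0.
  rewrite normrM (gtr0_norm eta0); apply: le_trans (bd i).
  by rewrite ler_piMl.
have N1 : \sum_(i < N) `|w i| <= N%:R * (1 + B).
  rewrite mulr_natl (_ : _ *+ N = \sum_(i < N) (1 + B)); last by rewrite sumr_const card_ord.
  exact: ler_sum.
have us' : \sum_i `|u 0 i| <= 2 * (N%:R * (1 + B)).
  apply: le_trans us _; rewrite ler_wpM2l//; under eq_bigr do rewrite mxE; exact: N1.
have ui i : lam * u 0 i = w i - \sum_j u 0 j * E j i.
  move/rowP/(_ i): uE; rewrite mulmxDr mul_mx_scalar !mxE => <-.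
  by rewrite addrK.
set q := (u *m (\col_i w i)) 0 0.
have qE : q = \sum_i u 0 i * w i by rewrite /q mxE; apply: eq_bigr => i _; rewrite !mxE.
pose D := \sum_i (\sum_j u 0 j * E j i) * w i.
have lq : lam * q = \sum_i w i ^+ 2 - D.
  rewrite qE mulr_sumr -sumrB; apply: eq_bigr => i _.
  by rewrite mulrA ui; ring.
pose S := \sum_i d i ^+ 2.
have w2 : \sum_i w i ^+ 2 = 1 + 2 * eta * d k + eta ^+ 2 * S.
  transitivity (\sum_i ((i == k)%:R * (1 + 2 * eta * d i) + eta ^+ 2 * d i ^+ 2)).
    apply: eq_bigr => i _; rewrite wE; case: (i == k) => /=; rewrite ?mulr1n ?mulr0n; ring.
  rewrite big_split/= -mulr_sumr (bigD1 k)//= eqxx mul1r big1 ?addr0//.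
  by move=> i ik; rewrite (negbTE ik) mul0r.
have DB : `|D| <= 2 * (N%:R * (1 + B)) ^+ 2 * (eta * Q).
  apply: (@le_trans _ _ (\sum_(i < N) (2 * (N%:R * (1 + B)) * (eta * Q) * `|w i|))).
    apply: le_trans (ler_norm_sum _ _ _) _; apply: ler_sum => i _.
    rewrite normrM ler_wpM2r//; apply: (@le_trans _ _ (\sum_j `|u 0 j| * (eta * Q))).
      apply: le_trans (ler_norm_sum _ _ _) _; apply: ler_sum => j _.
      by rewrite normrM ler_wpM2l.
    by rewrite -mulr_suml ler_wpM2r.
  rewrite -mulr_sumr; apply: (@le_trans _ _ (2 * (N%:R * (1 + B)) * (eta * Q) * (N%:R * (1 + B)))).
    rewrite ler_wpM2l//; apply: mulr_ge0 => //; apply: mulr_ge0 => //.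
    by apply: mulr_ge0 => //; exact: addr_ge0.
  by rewrite le_eqVlt; apply/orP; left; apply/eqP; ring.
have SB : `|S| <= N%:R * B ^+ 2.
  rewrite mulr_natl (_ : _ *+ N = \sum_(i < N) B ^+ 2); last by rewrite sumr_const card_ord.
  apply: le_trans (ler_norm_sum _ _ _) _; apply: ler_sum => i _.
  by rewrite normrX lerXn2r ?nnegrE.
have -> : lam * (q - 1) / eta - T = (2 * d k - e - T) + eta * S - D / eta.
  rewrite mulrBr mulr1 lq w2 lamE; field; rewrite gt_eqF//.
have DB' : `|D / eta| <= 2 * (N%:R * (1 + B)) ^+ 2 * Q.
  rewrite normrM normfV (gtr0_norm eta0) ler_pdivrMr//.
  by apply: le_trans DB _; rewrite le_eqVlt; apply/orP; left; apply/eqP; ring.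
have SB' : `|eta * S| <= N%:R * B ^+ 2 * eta.
  by rewrite normrM (gtr0_norm eta0) mulrC ler_wpM2r// ltW.
apply: le_trans (ler_normB _ _) _; apply: le_trans (lerD (ler_normD _ _) (lexx _)) _.
by lra.
Qed.

(** With [t = x_(n+1) / r], the normal component of the differential is [1 + (a/2) r^p (1 + p t^2)]
    up to errors. Its square contributes [a r^p + a p t^2 r^p], and the first term cancels against
    the conformal factor [1 + a r^p] of the metric. The error terms of the expansions are of order
    [r^(s-n-m) = r^p r^(s-1)]. *)
Lemma gradient_expansion : exists2 K : R, 0 < K & exists2 B0 : R, 0 < B0 &
  forall x : 'rV[R]_n.+1, U x -> B0 <= r x ->
  push_metric phi x \in unitmx /\
  `|(1 + a * r x `^ p) * (gradient_sq phi x - 1) / r x `^ p - a * p * (z x / r x) ^+ 2|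
     <= K * (r x `^ p + r x `^ (s - 1)).
Proof.
have n1 := @weight_gt1 _ _ X; have [_ /andP[s0 s1] _ _] := asymp.
have [C C0 HE] := metric_expansion asymp.
have [h [C' C'0 Hh]] := density_expansion asymp.
(* [C] serves the metric error; [4 * C'] is twice the bound [2 * C'] on the density error in [d],
   which enters doubled. *)
pose N : R := n.+1%:R; pose C2 := C + 4 * C'.
have C20 : 0 < C2 by rewrite /C2; lra.
pose B := `|a| * (1 + `|p|) + C2.
have ap0 : 0 <= `|a| * (1 + `|p|) by rewrite mulr_ge0// addr_ge0.
have B0 : 0 < B by rewrite /B; lra.
have p0 : p < 0 by lra.
have s10 : s - 1 < 0 by lra.
have N0 : 0 < N by [].
have K1 : 0 <= N * B ^+ 2 by rewrite mulr_ge0 ?sqr_ge0// ltW.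
have K2 : 0 <= (1 + 2 * (N * (1 + B)) ^+ 2) * C2.
  by rewrite mulr_ge0 ?(ltW C20)// addr_ge0// mulr_ge0 ?sqr_ge0.
exists (N * B ^+ 2 + (1 + 2 * (N * (1 + B)) ^+ 2) * C2 + 1); first by lra.
(* These thresholds give [|a| r^p <= 1/4], hence [lam >= 3/4], and [N C2 r^(s-1) <= 1/4], as
   [perturbed_inner] requires; the added 1 keeps the denominators positive. *)
have e1 : 0 < 1 / (4 * (1 + `|a|)) by rewrite divr_gt0// mulr_gt0// ltr_wpDr.
have e2 : 0 < 1 / (4 * (N * C2 + 1)).
  by rewrite divr_gt0// mulr_gt0// ltr_wpDl// mulr_ge0 ?ltW.
have [B1 B10 H1] := powR_small p0 e1; have [B2 B20 H2] := powR_small s10 e2.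
exists (Num.max B1 B2); first by rewrite lt_max B10.
move=> x xU; rewrite ge_max => /andP[/H1 x1 /H2 x2].
have [z0 r1] := xU; have r0 : 0 < r x by apply: lt_trans r1.
set eta := r x `^ p in x1 *; set q := r x `^ (s - 1) in x2 *.
have eta0 : 0 < eta by exact: powR_gt0.
have q0 : 0 < q by exact: powR_gt0.
have eta1 : eta <= 1 by rewrite /eta enorm_pow_le1// ltW.
have q1 : q <= 1 by rewrite /q enorm_pow_le1// ltW.
have a4 : `|a| * eta <= 1/4.
  have a1 : 0 < 1 + `|a| by rewrite ltr_wpDr.
  move: x1; rewrite ler_pdivlMr ?mulr_gt0// => x1.
  have : 0 <= eta by exact: ltW.
  nra.
have q4 : N * (C2 * q) <= 1/4.
  have a1 : 0 < N * C2 + 1 by rewrite ltr_wpDl// mulr_ge0 ?ltW.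
  move: x2; rewrite ler_pdivlMr ?mulr_gt0// => x2.
  have : N * (C2 * q) = N * C2 * q by rewrite mulrA.
  nra.
have alE : r x `^ al = eta * q.
  by rewrite -powRD ?(gt_eqF r0) ?implybT//; congr (_ `^ _); ring.
have al1E : r x * r x `^ (al - 1) = eta * q.
  rewrite -alE -{1}[r x]powRr1 ?(ltW r0)// -powRD ?(gt_eqF r0) ?implybT//.
  by congr (_ `^ _); ring.
have zr : z x <= r x by apply: le_trans (ler_norm _) (coord_le_enorm _ _).
have [VE bh dh] := Hh x xU.
pose d i := a / 2 * ((ord_max == i)%:R + p * (x 0 i / r x) * (z x / r x)) +
  ((ord_max == i)%:R * h x + z x * 'D_(e_ i) h x) / eta.
have gE i : gradient phi x i 0 = (i == ord_max)%:R + eta * d i.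
  rewrite mxE (partial_interior _ _ (interior_end_nbhs xU)).
  have [D1 _ _] := dh i.
  have Dz := is_derive_coord x i ord_max.
  have D2 : is_derive x (e_ i) (push_density phi) _ :=
    @is_derive_near _ _ (push_density phi) (density_pert phi + last_coord (n := n)) _ _ _
      (filterS (fun y _ => esym (subrK _ _)) (interior_end_nbhs xU)) (is_deriveD D1 Dz).
  have [_ ->] := D2; rewrite /d eq_sym.
  have -> : r x `^ (p - 2) = eta / r x ^+ 2.
    rewrite /eta powRD ?(gt_eqF r0) ?implybT// -powR_mulrn ?(ltW r0)//.
    by rewrite powRN.
  by rewrite -/eta; field; rewrite !gt_eqF.
have rest i : `|((ord_max == i)%:R * h x + z x * 'D_(e_ i) h x) / eta| <= 2 * C' * q.
  rewrite normrM normfV (gtr0_norm eta0) ler_pdivrMr//.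
  have b1 : `|(ord_max == i)%:R * h x| <= C' * (eta * q).
    rewrite normrM -alE; apply: le_trans bh.
    by case: (_ == _); rewrite ?normr1 ?normr0 ?mul1r ?mul0r.
  have b2 : `|z x * 'D_(e_ i) h x| <= C' * (eta * q).
    rewrite normrM (gtr0_norm z0) -al1E mulrCA; apply: ler_pM => //; first exact: ltW.
    by have [] := dh i.
  apply: le_trans (ler_normD _ _) _; apply: le_trans (lerD b1 b2) _.
  by rewrite le_eqVlt; apply/orP; left; apply/eqP; ring.
have dB i : `|d i| <= B.
  apply: le_trans (ler_normD _ _) _; rewrite /B; apply: lerD.
    rewrite normrM; apply: ler_pM => //.
      by rewrite normrM (ger0_norm (_ : 0 <= 2^-1 :> R)) ?invr_ge0// ler_piMr// invf_le1// ler1n.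
    apply: le_trans (ler_normD _ _) _; apply: lerD.
      by case: (_ == _); rewrite ?normr1 ?normr0.
    by rewrite -mulrA normrM ler_piMr// normrM; apply: mulr_ile1 => //; exact: ratio_le1.
  apply: le_trans (rest i) _; rewrite /C2.
  have : C' * q <= C' by rewrite ler_piMr ?(ltW C'0).
  lra.
pose Em := \matrix_(i, j) metric_error phi a i j x.
have GE : push_metric phi x = (1 + a * eta)%:M + Em.
  apply/matrixP => i j; rewrite [RHS]mxE [X in X + _]mxE [X in _ + X]mxE /metric_error.
  by rewrite -/eta -[(1 + a * eta) *+ _]mulr_natr; ring.
have EB i j : `|Em i j| <= eta * (C2 * q).
  rewrite mxE; have [_ b _] := HE i j x xU; apply: le_trans b _.
  rewrite alE mulrCA ler_wpM2l ?(ltW eta0)// ler_wpM2r ?(ltW q0)// /C2; lra.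
have l34 : 3/4 <= 1 + a * eta.
  have : - (`|a| * eta) <= a * eta.
    by rewrite -mulNr ler_wpM2r ?(ltW eta0)// lerNl -normrN ler_norm.
  lra.
have Ne : N * (eta * (C2 * q)) <= 1/4.
  apply: le_trans q4; rewrite mulrCA ler_piMl// mulr_ge0 ?(ltW N0)// mulr_ge0 ?ltW//.
have Q0 : 0 <= C2 * q by apply: mulr_ge0; exact: ltW.
have etaI : 0 < eta <= 1 by rewrite eta0.
split; first by rewrite GE; apply: perturbed_unit EB => //; rewrite mulr_ge0// ltW.
have dT : `|2 * d ord_max - a - a * p * (z x / r x) ^+ 2| <= C2 * q.
  have -> : 2 * d ord_max - a - a * p * (z x / r x) ^+ 2 =
      2 * ((((ord_max : 'I_n.+1) == ord_max)%:R * h x + z x * 'D_(e_ ord_max) h x) / eta).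
    by rewrite /d eqxx /= mulr1n -/(last_coord x); field; rewrite !gt_eqF.
  rewrite normrM ger0_norm//; have := rest ord_max.
  have : 0 <= C * q by apply: mulr_ge0; exact: ltW.
  rewrite /C2; lra.
have -> : gradient_sq phi x = ((\row_i gradient phi x i 0) *m invmx ((1 + a * eta)%:M + Em)
    *m (\col_i gradient phi x i 0)) 0 0.
  rewrite /gradient_sq -GE; congr ((_ *m _ *m _) 0 0).
    by apply/rowP => i; rewrite !mxE.
  by apply/colP => i; rewrite !mxE.
apply: le_trans (perturbed_inner l34 etaI Q0 Ne EB erefl gE dB dT) _.
rewrite -/N [X in _ + X <= _]mulrA.
move: K1 K2 eta0 q0; clear; move: (N * B ^+ 2) (_ * C2) eta q => k1 k2 e q h1 h2 e0 q0.
have h3 : 0 <= k1 * q by rewrite mulr_ge0// ltW.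
have h4 : 0 <= k2 * e by rewrite mulr_ge0// ltW.
by rewrite !mulrDl !mulrDr; lra.
Qed.

Lemma density_ratio : exists2 C : R, 0 < C & forall x : 'rV[R]_n.+1, U x ->
  `|push_density phi x / z x - 1| <= C * r x `^ p.
Proof.
have [_ /andP[s0 s1] _ _] := asymp.
have [h [C C0 Hh]] := density_expansion asymp.
exists (`|a / 2| + C); first by rewrite ltr_wpDl.
move=> x xU; have [-> bh _] := Hh x xU; have [z0 r1] := xU.
rewrite (_ : _ / _ - 1 = a / 2 * r x `^ p + h x); last by field; rewrite gt_eqF.
apply: le_trans (ler_normD _ _) _; rewrite mulrDl; apply: lerD.
  by rewrite normrM [`|_ `^ _|]ger0_norm ?powR_ge0.
apply: le_trans bh _; rewrite ler_wpM2l ?(ltW C0)// ler_powR ?(ltW r1)//; lra.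
Qed.

(** Convergence along this filter is uniform in the direction, including directions arbitrarily
    close to the boundary. *)
Definition end_filter : set_system 'rV[R]_n.+1 :=
  [set A | exists B : R, forall x, U x -> B <= r x -> A x].

Lemma end_filter_filter : Filter end_filter.
Proof.
split.
- by exists 0.
- move=> P Q [B HB] [B' HB']; exists (Num.max B B') => x xU.
  by rewrite ge_max => /andP[h1 h2]; split; [exact: HB|exact: HB'].
- by move=> P Q PQ [B HB]; exists B => x xU h; apply: PQ; exact: HB.
Qed.
#[local] Existing Instance end_filter_filter.

Lemma end_filter_pow (q : R) : q < 0 -> r x `^ q @[x --> end_filter] --> (0 : R).
Proof.
move=> q0; apply/cvgrPdist_le => e e0; have [B B0 HB] := powR_small q0 e0.
exists B => x xU xB; rewrite /= sub0r normrN ger0_norm ?powR_ge0//; exact: HB.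
Qed.

(* Up to a factor tending to 1, [|grad v|^2 - 1] is [a p z^2 r^(p-2)], and [v]
   is [z]; multiplying by [v^(-p)] leaves a function of the direction only. *)
Lemma gradient_asymptotics (eps : R) : 0 < eps -> exists2 B : R, 0 < B &
  forall x : 'rV[R]_n.+1, U x -> B <= r x ->
  [/\ push_metric phi x \in unitmx, z x / 2 <= push_density phi x &
  `|(gradient_sq phi x - 1) * push_density phi x `^ (- p)
     - a * p * (z x / r x) `^ (2 - p)| <= eps].
Proof.
have n1 := @weight_gt1 _ _ X; have [_ /andP[s0 s1] _ _] := asymp.
have p0 : p < 0 by lra.
have s10 : s - 1 < 0 by lra.
move=> eps0.
have [K K0 [B0 B00 HK]] := gradient_expansion.
have [C C0 HC] := density_ratio.
have eta_cvg := end_filter_pow p0; have q_cvg := end_filter_pow s10.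
pose kap x := push_density phi x / z x.
have kap_cvg : kap x @[x --> end_filter] --> (1 : R).
  apply/cvgrPdist_le => e e0; have eC : 0 < e / C by rewrite divr_gt0.
  have /cvgrPdist_le/(_ _ eC) := eta_cvg; apply: filterS2; last first.
    by exists 0 => x xU _; exact: (HC x xU).
  move=> x h1; rewrite sub0r normrN ger0_norm ?powR_ge0// ler_pdivlMr// mulrC => h2.
  by rewrite distrC; exact: le_trans h1 h2.
have lam_cvg : 1 + a * r x `^ p @[x --> end_filter] --> (1 : R).
  rewrite -[X in _ --> X]addr0 -(mulr0 a).
  by apply: cvgD; [exact: cvg_cst|apply: cvgM; [exact: cvg_cst|exact: eta_cvg]].
(* [th] collects the two factors that tend to 1: the one from replacing the density by [x_(n+1)] and
   the one from [lam]. *)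
pose th x := kap x `^ (- p) / (1 + a * r x `^ p).
have th_cvg : th x @[x --> end_filter] --> (1 : R).
  rewrite -[X in _ --> X]divr1; apply: cvgM.
    have c1 : {for (1 : R), continuous (fun y : R => y `^ (- p))}.
      apply/differentiable_continuous/derivable1_diffP/derivable_powR.
      by rewrite in_itv/= ltr01.
    have c2 : y `^ (- p) @[y --> (1 : R)] --> (1 : R).
      have E1 : (1 : R) `^ (- p) = 1 by rewrite powR1.
      by rewrite -[X in _ --> X]E1; exact: c1.
    by move=> A /c2 cA; exact: (kap_cvg _ cA).
  by apply: cvgV => //; exact: oner_neq0.
pose del (x : 'rV[R]_n.+1) := K * (r x `^ p + r x `^ (s - 1)).
have del_cvg : del x @[x --> end_filter] --> (0 : R).
  rewrite -(mulr0 K); apply: cvgM; first exact: cvg_cst.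
  by rewrite -[X in _ --> X]addr0; apply: cvgD.
have tot : `|th x - 1| * `|a * p| + `|th x| * del x @[x --> end_filter] --> (0 : R).
  rewrite (_ : (0 : R) = `|(1 : R) - 1| * `|a * p| + `|(1 : R)| * 0); last first.
    by rewrite subrr normr0 mul0r mulr0 addr0.
  apply: cvgD; apply: cvgM => //; last exact: cvg_norm.
    by apply: cvg_norm; apply: cvgB => //; exact: cvg_cst.
  exact: cvg_cst.
have /cvgrPdist_le/(_ _ eps0)[B1 H1] := tot.
have h2 : 0 < 1/2 :> R by lra.
have /cvgrPdist_le/(_ _ h2)[B2 H2] := kap_cvg.
have /cvgrPdist_le/(_ _ h2)[B3 H3] := lam_cvg.
exists (Num.max B0 (Num.max B1 (Num.max B2 B3))); first by rewrite lt_max B00.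
move=> x xU; rewrite !ge_max => /and4P[xB0 xB1 xB2 xB3].
have [z0 r1] := xU; have r0 : 0 < r x by apply: lt_trans r1.
have [GU HG] := HK x xU xB0.
have k2 : 1/2 <= kap x.
  by have := H2 x xU xB2; rewrite /= ler_norml => /andP[_]; lra.
have l2 : 1/2 <= 1 + a * r x `^ p.
  by have := H3 x xU xB3; rewrite /= ler_norml => /andP[_]; lra.
split=> //.
  by move: k2; rewrite /kap ler_pdivlMr// => k2; lra.
have VE : push_density phi x = z x * kap x by rewrite /kap mulrCA mulfV ?mulr1// gt_eqF.
have kx0 : 0 <= kap x by lra.
set lam := 1 + a * r x `^ p in l2 HG *.
set eta := r x `^ p in HG *.
have eta0 : 0 < eta by exact: powR_gt0.
have lam0 : 0 < lam by lra.
set t := z x / r x in HG *.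
have t0 : 0 < t by rewrite divr_gt0.
have t1 : t <= 1.
  by apply: le_trans (ler_norm _) _; exact: ratio_le1.
set Y := gradient_sq phi x - 1 in HG *.
(* As [x_(n+1) = t r], the power of the density supplies exactly the [1 / eta] by which the
   expansion of the gradient is normalised. *)
have VpE : push_density phi x `^ (- p) = t `^ (- p) / eta * kap x `^ (- p).
  rewrite VE powRM ?(ltW z0)//; congr (_ * _).
  have -> : z x = t * r x by rewrite /t divfK// gt_eqF.
  by rewrite powRM ?(ltW t0) ?(ltW r0)// [r x `^ (- p)]powRN.
have tE : t `^ (2 - p) = t `^ (- p) * t ^+ 2.
  rewrite -powR_mulrn ?(ltW t0)// -powRD ?(gt_eqF t0) ?implybT//.
  by congr (_ `^ _); ring.
(* Here [p < 0] is decisive: the factor stays bounded as [t] tends to 0, so the estimate is uniform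
   up to the boundary. *)
have tp1 : t `^ (- p) <= 1.
  rewrite -[leRHS](powRr0 t); apply: ger_powR; first by rewrite t0.
  by rewrite oppr_ge0 ltW.
have t21 : `|t `^ (- p) * t ^+ 2| <= 1.
  rewrite normrM mulr_ile1//; first by rewrite ger0_norm ?powR_ge0.
  by rewrite ger0_norm ?sqr_ge0// exprn_ile1// ltW.
have thE : th x = kap x `^ (- p) / lam by [].
set W := lam * Y / eta - a * p * t ^+ 2 in HG.
have -> : Y * push_density phi x `^ (- p) - a * p * t `^ (2 - p) =
    (th x - 1) * (a * p) * (t `^ (- p) * t ^+ 2) + th x * (W * t `^ (- p)).
  by rewrite VpE tE thE /W; field; rewrite !gt_eqF.
have := H1 x xU xB1; rewrite /= sub0r normrN => h1.
apply: le_trans _ (le_trans (ler_norm _) h1).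
apply: le_trans (ler_normD _ _) _; apply: lerD.
  by rewrite [leLHS]normrM [X in X * _ <= _]normrM ler_piMr// mulr_ge0.
rewrite normrM ler_wpM2l// normrM [`|t `^ _|]ger0_norm ?powR_ge0//.
apply: le_trans HG; rewrite ler_piMr//.
Qed.

End GradientAsymptotics.

(** * Comparison of two asymptotic charts *)

Section Uniqueness.
Context {R : realType} {n : nat} (X : smms R n).
Local Notation U := (interior_end n).
Local Notation m := (weight X).
Local Notation p := (1 - n%:R - m).
Local Notation r x := (enorm x).
Local Notation z x := (last_coord x).

(** The number [tau] is a power of the direction cosine, in the second chart, of an axis point of
    the first. It depends on [eps], because that point is chosen far out in terms of [eps]. *)
Lemma direction_comparison (phi psi : chart R n X) (a a' s eps : R) :
  asymptotically_Schwarzschild phi a s -> asymptotically_Schwarzschild psi a' s ->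
  0 < eps -> exists2 tau, 0 <= tau <= 1 & `|a * p - a' * p * tau| <= eps.
Proof.
move=> Ha Ha' eps0; have e2 : 0 < eps / 2 by rewrite divr_gt0.
have n1 := @weight_gt1 _ _ X.
have [endphi _ _ _] := Ha; have [endpsi /andP[s0 s1] _ [h' [C' C'0 Hh'] Eh']] := Ha'.
have [B B0 HB] := gradient_asymptotics Ha e2.
have [B' B'0 HB'] := gradient_asymptotics Ha' e2.
have [chpsi [K' cK' dompsi] codpsi _] := endpsi.
have [chphi _ codphi _] := endphi.
have [D HD] := density_bounded cK'.
(* [M] bounds the ratio of the density to the last coordinate throughout the end of [psi]. *)
pose M := 1 + `|a' / 2| + C'.
have M0 : 0 < M by rewrite /M; have := normr_ge0 (a' / 2); lra.
(* [B] makes the asymptotics in [phi] available and 2 puts the point in the end. As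
   [density P >= rho / 2], the term [2 |D|] moves [P] out of the compact set omitted by [psi], and
   [2 (B' M)] forces [|y| >= B'] through [density P <= M |y|]. *)
pose rho := B + 2 + 2 * `|D| + 2 * (B' * M).
have BM : 0 < B' * M by rewrite mulr_gt0.
have D0 := normr_ge0 D; have D1 := ler_norm D.
have rho1 : 1 < rho by rewrite /rho; lra.
have rho0 : 0 < rho by lra.
pose x : 'rV[R]_n.+1 := rho *: delta_mx 0 ord_max.
have zx : z x = rho by rewrite /last_coord !mxE !eqxx mulr1.
have rx : r x = rho.
  rewrite /enorm (bigD1 ord_max)//= big1 ?addr0.
    by rewrite !mxE !eqxx mulr1 sqrtr_sqr ger0_norm// ltW.
  by move=> j jm; rewrite !mxE (negbTE jm) andbF mulr0 expr0n.
have xU : U x by split; rewrite ?zx ?rx.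
have xB : B <= r x by rewrite rx /rho; lra.
have [GU Vx Hx] := HB x xU xB.
set P := chart_point phi x.
have Vlow : rho / 2 <= density P by move: Vx; rewrite zx.
have PD : D < density P by move: Vlow; rewrite /rho; lra.
have Pdom : chart_dom psi P.
  by rewrite dompsi => PK; have := HD P PK; rewrite leNgt PD.
have [_ _ psiK _ _] := chpsi.
pose y := chart_coord psi P.
have yP : chart_point psi y = P by exact: psiK.
have yE : exterior R n y by rewrite -codpsi; exists P.
have Vy : density P = (1 + a' / 2 * r y `^ p) * z y + z y * h' y.
  by rewrite -Eh'// /push_density yP.
have [zy ry] := yE.
have ry0 : 0 < r y by lra.
have Vpos : 0 < density P by lra.
(* On the boundary the expansion in [psi] would give density 0. *)
have zy0 : 0 < z y.
  rewrite lt_neqAle zy andbT; apply: contraTneq Vpos => E.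
  by rewrite Vy -E mulr0 mul0r addr0 ltxx.
have yU : U y by [].
have rp1 : r y `^ p <= 1 by rewrite enorm_pow_le1//; lra.
have rp0 : 0 <= r y `^ p := powR_ge0 _ _.
have hy : `|h' y| <= C'.
  apply: le_trans (Hh' y yE).1 _; rewrite ler_piMr ?(ltW C'0)// enorm_pow_le1//; lra.
have zr : z y <= r y by apply: le_trans (ler_norm _) (coord_le_enorm _ _).
have yB : B' <= r y.
  have V1 : density P <= z y * M.
    rewrite Vy (_ : _ + _ = z y * (1 + a' / 2 * r y `^ p + h' y)); last by ring.
    rewrite ler_wpM2l// /M; apply: lerD; last exact: le_trans (ler_norm _) hy.
    rewrite lerD2l; apply: le_trans (ler_norm _) _.
    by rewrite normrM [`|_ `^ _|]ger0_norm// ler_piMr.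
  have V2 : z y * M <= r y * M by rewrite ler_wpM2r// ltW.
  have : B' * M <= r y * M.
    apply: le_trans (le_trans V1 V2); apply: le_trans Vlow; rewrite /rho; lra.
  by rewrite ler_pM2r.
have [GU' _ Hy] := HB' y yU yB.
have dx : density (chart_point phi x) != 0 by rewrite gt_eqF.
have dy : density (chart_point psi y) != 0 by rewrite yP gt_eqF.
have gx := gradient_sq_chart endphi xU dx GU.
have gy := gradient_sq_chart endpsi yU dy GU'.
have gxy : gradient_sq phi x = gradient_sq psi y by rewrite gx gy yP.
have Vxy : push_density phi x = push_density psi y by rewrite /push_density yP.
exists ((z y / r y) `^ (2 - p)).
  rewrite powR_ge0/= -[leRHS](powRr0 (z y / r y)); apply: ger_powR; last by lra.
  by rewrite divr_gt0//=; apply: le_trans (ler_norm _) _; exact: ratio_le1.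
move: Hx; rewrite gxy Vxy zx rx divff ?gt_eqF// powR1 mulr1 => Hx.
set q := (_ - 1) * _ in Hx Hy.
set b := a' * p * _ in Hy *.
rewrite (_ : a * p - b = (q - b) - (q - a * p)); last by ring.
apply: le_trans (ler_normB _ _) _; apply: le_trans (lerD Hy Hx) _; lra.
Qed.

(** Since [0 <= tau <= 1], comparison in both directions gives [|a p| = |a' p|]. If the signs
    differ, it bounds [|a p| (1 + tau)], and so [|a p|], by every positive [eps]; both coefficients
    then vanish. No limit of [tau] is taken. *)
Lemma mass_coefficient_unique (phi psi : chart R n X) (a a' s : R) :
  asymptotically_Schwarzschild phi a s -> asymptotically_Schwarzschild psi a' s ->
  a' = a.
Proof.
move=> Ha Ha'; have n1 := @weight_gt1 _ _ X.
have p0 : p < 0 by lra.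
have le1 (phi1 phi2 : chart R n X) (b b' : R) : asymptotically_Schwarzschild phi1 b s ->
    asymptotically_Schwarzschild phi2 b' s -> `|b * p| <= `|b' * p|.
  move=> H H'; apply/ler_addgt0Pr => e e0.
  have [tau /andP[t0 t1] Ht] := direction_comparison H H' e0.
  rewrite -[b * p](subrK (b' * p * tau)) addrC; apply: le_trans (ler_normD _ _) _.
  by apply: lerD => //; rewrite normrM (ger0_norm t0) ler_piMr.
have : `|a' * p| = `|a * p|.
  by apply/le_anti/andP; split; [exact: le1 Ha' Ha|exact: le1 Ha Ha'].
move/eqP; rewrite eqr_norm2 => /orP[/eqP|/eqP] E.
  by apply: (mulIf _ E); rewrite lt_eqF.
have ap0 : `|a * p| <= 0.
  apply/ler_addgt0Pr => e e0; rewrite add0r.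
  have [tau /andP[t0 t1] Ht] := direction_comparison Ha Ha' e0.
  apply: le_trans Ht; rewrite E mulNr opprK.
  rewrite (_ : a * p + _ = a * p * (1 + tau)); last by ring.
  have t2 : 0 <= 1 + tau by lra.
  by rewrite [leRHS]normrM (ger0_norm t2) ler_peMr//; lra.
have a0 : a * p = 0 by apply/eqP; rewrite -normr_le0.
apply: (mulIf (_ : p != 0)); first by rewrite lt_eqF.
by rewrite E a0 oppr0.
Qed.

End Uniqueness.

Theorem theorem1p1 (R : realType) (n : nat) (X : smms R n)
    (phi : chart R n (smms_space X)) (a s : R)
    (n_ge2 : (2 <= n)%N)
    (phi_asymp : asymptotically_Schwarzschild phi a s)
    (weight_cases : 0 <= weight X < 1 \/
       (-1 < weight X < 0 /\ refined_metric_error phi a s)) :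
  [/\ mass_exists phi,
      sigma_integrable n (weight X),
      mass phi = (weight X + n%:R) * (weight X + n%:R - 1) * a
                   * sigma n (weight X) &
      forall (psi : chart R n (smms_space X)) (a' : R),
        asymptotically_Schwarzschild psi a' s ->
        (weight X < 0 -> refined_metric_error psi a' s) ->
        a' = a /\ mass psi = mass phi].
Proof.
have n_gt0 : (0 < n)%N by exact: leq_trans n_ge2.
have [phi_mass phi_sigma phi_massE] := mass_formula phi_asymp weight_cases n_gt0.
split; [exact: phi_mass|exact: phi_sigma|exact: phi_massE|].
move=> psi a' psi_asymp psi_refined.
have a'E := mass_coefficient_unique phi_asymp psi_asymp.
(* The weight belongs to the space, so [psi] falls into the same case as [phi], with its own refined
   expansion when the weight is negative. *)
have psi_cases : 0 <= weight X < 1 \/ (-1 < weight X < 0 /\ refined_metric_error psi a' s).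
  case: weight_cases => [|[m01 _]]; [by left|right].
  by split=> //; apply: psi_refined; case/andP: m01.
have [_ _ psi_massE] := mass_formula psi_asymp psi_cases n_gt0.
split; first exact: a'E.
by rewrite phi_massE psi_massE a'E.
Qed.
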